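(* Let $N=(G,x)$ and $N'=(G',x')$ be two perfect networks, each with $k$ boundary sources and $n-k$ boundary sinks, such that: (1) $G$ and $G'$ are isomorphic as undirected graphs (embedded in the disk, with the same boundary vertices); (2) every internal vertex $v$ of degree different from $2$ has the same color in $N$ and $N'$; (3) if an edge $e$ has the same orientation in $N$ and $N'$ then $x_e=x'_e$, and if $N$ contains $e=(u,v)$ while $N'$ contains the same undirected edge oriented as $e'=(v,u)$, then $x_e=(x'_{e'})^{-1}$. Then $\mathit{Meas}(N)=\mathit{Meas}(N')$ in $Gr_{kn}$.
   Context: A planar directed network: a directed graph drawn in a disk (loops, multiple edges allowed), with boundary vertices $b_1,\dots,b_n$ clockwise on the boundary circle, each a source or a sink, internal vertices inside, positive edge weights $x_e$. A perfect network is such a network in which every boundary vertex has degree $1$ and each internal vertex either has exactly one outgoing edge (all others incoming) or exactly one incoming edge (all others outgoing). The color of an internal vertex of degree $\ne2$ is $1$ (black) if it has exactly one outgoing edge and $-1$ (white) if it has exactly one incoming edge. $\mathit{wind}(P)$ for a directed path $P$ between boundary vertices is the signed number of full turns of its tangent (counterclockwise positive; erasing a counterclockwise/clockwise cycle changes it by $+1/-1$; simple paths have index $0$). The boundary measurement $M_{ij}$ is the value at the weights of the subtraction-free rational expression to which $\sum_{P:b_i\to b_j}(-1)^{\mathit{wind}(P)}\prod_{e\in P}x_e$ sums. For source set $I$, $\mathit{Meas}(N)\in Gr_{kn}$ (the Grassmannian of $k$-planes in $\mathbb{R}^n$, with Plücker coordinates $\Delta$) is the point with $\Delta_I\neq0$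 and $\Delta_{(I\setminus\{i\})\cup\{j\}}/\Delta_I=M_{ij}$ for $i\in I$, $j\notin I$. *)

(* Defs.v *)
From HB Require Import structures.
From mathcomp Require Import all_boot all_order all_fingroup all_algebra.
From mathcomp Require Import mpoly.

Set Implicit Arguments.
Unset Strict Implicit.
Unset Printing Implicit Defensive.

Import Order.TTheory GRing.Theory Num.Theory.
Local Open Scope ring_scope.

(* An undirected graph drawn in a disk, up to isotopy, with boundary vertices
   b_1, ..., b_n of degree 1 in clockwise order, as a combinatorial map.
   A dart is an edge together with one of its two ends (a loop has two darts at
   the same vertex); [twin] goes to the other end of the edge, and [turn] goes
   to the next dart counterclockwise around the vertex.  The boundary circle is
   collapsed to one point, so that the disk becomes a sphere: the darts
   [leg i] at the boundary vertices are consecutive around that point, and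
   clockwise order along the circle is counterclockwise order around it. *)
Definition face_perm (D : finType) (twin turn : {perm D}) : {perm D} :=
  (twin * turn^-1)%g.

Definition map_link (D : finType) (twin turn : {perm D}) : rel D :=
  fun d d' => (d' == twin d) || (d' == turn d).

(* [dm_planar] is Euler's formula V - E + F = 2 C, where C is the number of
   connected components: every component has genus 0.  The face of a dart is
   the one on its left when moving along the edge away from the dart's vertex. *)
Record disk_map (n : nat) := DiskMap {
  dart : finType;
  twin : {perm dart};
  turn : {perm dart};
  leg : 'I_n -> dart;
  dm_twinK : involutive twin;
  dm_twin_neq : forall d, twin d != d;
  dm_leg_inj : injective leg;
  dm_turn_leg : forall i, turn (leg i) = leg (ordS i);
  dm_planar :
    (#|porbits turn| + #|porbits (face_perm twin turn)|
     = #|porbits twin| + 2 * n_comp (map_link twin turn) predT)%N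
}.

Section DiskMap.
Variables (n : nat) (G : disk_map n).

Definition internal (d : dart G) : bool := d \notin codom (leg G).

(* The set of darts at the vertex of [d]: the collapsed boundary circle is
   split again into the vertices b_i. *)
Definition vtx (d : dart G) : {set dart G} :=
  if internal d then porbit (turn G) d else [set d].

Definition degree (d : dart G) : nat := #|vtx d|.

(* Reachability of faces (each represented by the darts having it on their
   left) without crossing the edges of the cycle [c]. *)
Definition face_link (c : seq (dart G)) : rel (dart G) :=
  fun a b => (b == face_perm (twin G) (turn G) a)
    || [&& b == twin G a, a \notin c & twin G a \notin c].

(* A simple directed cycle [c] of internal vertices is counterclockwise iff the
   region on its left is its inside, i.e. does not reach the boundary circle. *)
Definition counterclockwise (c : seq (dart G)) : bool :=
  ~~ [exists d in c, exists i : 'I_n, connect (face_link c) d (leg G i)].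

Definition cycle_wind (c : seq (dart G)) : int :=
  if counterclockwise c then 1 else -1.

(* The winding index by chronological loop erasure: [s] is the simple path
   obtained so far and [p] what remains of the path.  When the path returns to
   the vertex at the tail of an element of [s], the simple cycle just closed is
   erased and contributes 1 or -1; a simple path contributes 0.
   (If some vertex had two incoming and two outgoing edges, there would be a
   further contribution from paths crossing themselves; this does not occur in
   a perfect network.) *)
Fixpoint wind_from (s p : seq (dart G)) : int :=
  if p is d :: p' then
    let s' := rcons s d in
    let k := find (fun a => a \in vtx (twin G d)) s' in
    if (k < size s')%N then cycle_wind (drop k s') + wind_from (take k s') p'
    else wind_from s' p'
  else 0.

Definition wind (p : seq (dart G)) : int := wind_from [::] p.

End DiskMap.

(* An edge is directed away from the one of its darts that is [out]; the
   directed edge is identified with that dart. *)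
Record network (R : realFieldType) (n : nat) := Network {
  net_map :> disk_map n;
  out : dart net_map -> bool;
  weight : dart net_map -> R;
  out_twin : forall d, out (twin net_map d) = ~~ out d;
  weight_twin : forall d, weight (twin net_map d) = weight d;
  weight_gt0 : forall d, 0 < weight d
}.

Section Network.
Variables (R : realFieldType) (n : nat) (N : network R n).

Definition outdegree (d : dart N) : nat := #|[set x in vtx d | out x]|.
Definition indegree (d : dart N) : nat := #|[set x in vtx d | ~~ out x]|.

Definition perfect : Prop :=
  forall d : dart N, internal d -> outdegree d = 1%N \/ indegree d = 1%N.

(* For perfect networks and internal vertices of degree different from 2. *)
Definition color (d : dart N) : int := if outdegree d == 1%N then 1 else -1.

Definition sources : {set 'I_n} := [set i | out (leg N i)].

Definition step : rel (dart N) := fun d d' => out d' && (d' \in vtx (twin N d)).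

Definition dpath (i j : 'I_n) (p : seq (dart N)) : bool :=
  if p is d :: q then
    [&& d == leg N i, out d, path step d q & twin N (last d q) == leg N j]
  else false.

Definition pmonom (p : seq (dart N)) : 'X_{1..#|dart N|} :=
  [multinom count_mem (enum_val v) p | v < #|dart N|].

(* Coefficient of the monomial [m] in the formal power series
   \sum_(P : b_i -> b_j) (-1)^wind(P) \prod_(e in P) x_e; only the finitely
   many paths with [mdeg m] edges can contribute. *)
Definition meas_coef (i j : 'I_n) (m : 'X_{1..#|dart N|}) : int :=
  \sum_(p : (mdeg m).-tuple (dart N) | dpath i j p && (pmonom p == m))
     (-1) ^ wind p.

End Network.

Definition subtraction_free (v : nat) (f : {mpoly int[v]}) : Prop :=
  forall m, 0 <= f@_m.

(* The formal power series with coefficients [S] sums to [f / g], i.e.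
   g * S = f. *)
Definition sums_to (v : nat) (S : 'X_{1..v} -> int) (f g : {mpoly int[v]}) :
    Prop :=
  forall m, f@_m = \sum_(a <- msupp g | (a <= m)%MM) g@_a * S (m - a)%MM.

Definition eval_weights (R : realFieldType) (n : nat) (N : network R n)
    (f : {mpoly int[#|dart N|]}) : R :=
  (map_mpoly intr f).@[fun v => weight (enum_val v)].

(* M_ij = r *)
Definition boundary_measurement (R : realFieldType) (n : nat)
    (N : network R n) (i j : 'I_n) (r : R) : Prop :=
  exists f g : {mpoly int[#|dart N|]},
    [/\ subtraction_free f, subtraction_free g, g != 0,
        sums_to (@meas_coef R n N i j) f g
      & r = eval_weights f / eval_weights g].

Definition grassmannian (R : realFieldType) (k n : nat) :=
  {V : {vspace 'rV[R]_n} | \dim V == k}.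

(* For #|J| = k, the maximal minor with columns J, in increasing order, of the
   matrix whose rows are a basis of the plane; another basis would multiply all
   of them by the same nonzero scalar. *)
Definition plucker (R : realFieldType) (k n : nat) (X : grassmannian R k n)
    (J : {set 'I_n}) : R :=
  \det (\matrix_(a < #|J|, c < #|J|) (vbasis (val X))`_a 0 (enum_val c)).

(* Meas(N) = X *)
Definition is_Meas (R : realFieldType) (k n : nat) (N : network R n)
    (X : grassmannian R k n) : Prop :=
  let I := sources N in
  plucker X I != 0 /\
  (forall i j, i \in I -> j \notin I ->
     boundary_measurement N i j (plucker X (j |: (I :\ i)) / plucker X I)).

(* Isomorphism of undirected graphs embedded in the disk, preserving the
   boundary vertices. *)
Definition disk_map_iso (n : nat) (G G' : disk_map n)
    (phi : dart G -> dart G') : Prop :=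
  [/\ bijective phi,
      (forall d, phi (twin G d) = twin G' (phi d)),
      (forall d, phi (turn G d) = turn G' (phi d))
    & (forall i, phi (leg G i) = leg G' i)].

(* Main.v *)
(* Only the parity of the winding index matters, so a path counts with the sign
   (-1)^(number of erased cycles), and moving the first cycle met by a path
   between the path and a disjoint family of cycles is a sign-reversing
   involution.  Hence M_ij is the quotient of the generating function of the
   flows from b_i to b_j by that of the flows without boundary edges (Talaska's
   formula).  In a perfect network a flow is the set of edges to be reversed in
   order to obtain another orientation with the same outdegrees at all internal
   vertices, so M_ij = Z_J / Z_I, where J = (I \ i) + j and Z_J sums over these
   orientations with source set J.  Replacing N by N' multiplies all Z_J by the
   same constant.  The Z_J satisfy the three-term Plucker relations: two such
   orientations differ along disjoint strands, exchanging them along one strand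
   preserves the product of the weights, and by planarity strands do not cross.
   Reversing the strands between the two orientations one at a time, the
   three-term relations show that the plane with Plucker coordinates Z_J / Z_I
   near I also has them near the source set of N'. *)
Require Import Defs.
From HB Require Import structures.
From mathcomp Require Import all_boot all_order all_fingroup all_algebra.
From mathcomp Require Import mpoly zify ring.

Set Implicit Arguments.
Unset Strict Implicit.
Unset Printing Implicit Defensive.

Import Order.TTheory GRing.Theory Num.Theory.
Local Open Scope ring_scope.

(** [is_Meas] fixes only the coordinates one exchange away from the source set I, whereas the source
    set of N' can be far from I and some Z_J can vanish. A three-term relation yields a coordinate
    two exchanges away from J only after division by Z_J, so every J passed on the way must be the
    source set of an actual orientation; strands provide such a chain. Perfectness acts through one
    local fact: at an internal vertex a flow has at most one incoming and one outgoing edge, and two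
    orientations differ in no dart or in exactly two. Hence flows and differences of orientations
    are vertex-disjoint unions of paths and cycles. This makes strands well defined and the transfer
    of a cycle between a path and a flow reversible. The common constant arises because every
    orientation contains exactly one dart of each edge: a factor that depends on the edge alone
    contributes the same product to every orientation. *)

Section Vertices.
Variables (n : nat) (G : disk_map n).
Implicit Types (d x y : dart G) (i : 'I_n).

Lemma internal_leg i : internal (leg G i) = false.
Proof. by rewrite /internal codom_f. Qed.

Lemma internalPn d : reflect (exists i, d = leg G i) (~~ internal d).
Proof. by rewrite negbK; exact: codomP. Qed.

Lemma vtx_leg i : vtx (leg G i) = [set leg G i].
Proof. by rewrite /vtx internal_leg. Qed.

Lemma internal_turn d : internal (turn G d) = internal d.
Proof.
apply/negb_inj; apply/internalPn/internalPn => -[i].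
  rewrite -[i]ord_predK -dm_turn_leg => /perm_inj ->; by eexists.
by move=> ->; exists (ordS i); rewrite dm_turn_leg.
Qed.

Lemma internal_porbit x d : x \in porbit (turn G) d -> internal x = internal d.
Proof.
case/porbitP => k ->; elim: k => [|k IH]; first by rewrite expg0 perm1.
by rewrite expgSr permM internal_turn.
Qed.

Lemma vtx_id d : d \in vtx d.
Proof. by rewrite /vtx; case: ifP => _; rewrite ?porbit_id ?set11. Qed.

Lemma internal_vtx x d : x \in vtx d -> internal x = internal d.
Proof.
rewrite /vtx; case: ifP => [hd /internal_porbit ->//|hd].
by rewrite inE => /eqP ->.
Qed.

Lemma vtx_eq x y : (x \in vtx y) = (vtx x == vtx y).
Proof.
apply/idP/eqP => [xy|<-]; last exact: vtx_id.
have := xy; rewrite /vtx (internal_vtx xy); case: ifP => hy.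
  by rewrite porbit_sym -eq_porbit_mem eq_sym => /eqP.
by rewrite inE => /eqP ->.
Qed.

Lemma vtx_sym x y : (x \in vtx y) = (y \in vtx x).
Proof. by rewrite !vtx_eq eq_sym. Qed.

Lemma vtx_same x y : x \in vtx y -> vtx x = vtx y.
Proof. by rewrite vtx_eq => /eqP. Qed.

Lemma twinK : involutive (twin G).
Proof. exact: dm_twinK. Qed.

End Vertices.

(** * Planarity: even edge sets bound sets of faces *)

Section PlanarColoring.
Variables (T : finType).

Lemma map_link_sym (tw tu : {perm T}) : connect_sym (map_link tw tu).
Proof.
have step1 x y : map_link tw tu x y -> connect (map_link tw tu) y x.
  case/orP => /eqP ->.
    have: fconnect tw (tw x) x by rewrite fconnect_sym ?fconnect1 //; exact: perm_inj.
    by apply: connect_sub => a b /eqP <-; apply: connect1; rewrite /map_link eqxx.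
  have: fconnect tu (tu x) x by rewrite fconnect_sym ?fconnect1 //; exact: perm_inj.
  by apply: connect_sub => a b /eqP <-; apply: connect1; rewrite /map_link eqxx orbT.
apply: symmetric_from_pre => x y /connectP[p]; elim: p x => [|z p IH] x /=.
  by move=> _ ->.
by case/andP => xz pz yl; apply: connect_trans (IH _ pz yl) (step1 _ _ xz).
Qed.

Lemma porbits_memP (s : {perm T}) x : porbit s x \in porbits s.
Proof. exact: imset_f. Qed.

(** Numbering the orbits turns functions on vertices, edges or faces into row vectors, so that
    Euler's formula can be used as a statement about ranks. *)
Definition porbit_index (s : {perm T}) (x : T) : 'I_#|porbits s| :=
  enum_rank_in (porbits_memP s x) (porbit s x).

Lemma porbit_index_eq (s : {perm T}) x y : (porbit_index s x == porbit_index s y) = (x \in porbit s y).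
Proof.
rewrite -eq_porbit_mem; apply/eqP/eqP => [/(congr1 (@enum_val _ _))|].
  by rewrite /porbit_index !enum_rankK_in ?porbits_memP.
by move=> e; apply: enum_val_inj; rewrite /porbit_index !enum_rankK_in ?porbits_memP.
Qed.

Lemma porbit_index_perm (s : {perm T}) x : porbit_index s (s x) = porbit_index s x.
Proof. by apply/eqP; rewrite porbit_index_eq -{1}[s]expg1 mem_porbit. Qed.

Lemma porbit_index_surj (s : {perm T}) i : exists x, i = porbit_index s x.
Proof.
have /imsetP[x _ ix] := enum_valP i; exists x.
by apply: enum_val_inj; rewrite /porbit_index enum_rankK_in ?porbits_memP.
Qed.

Local Notation F2 := 'F_2.

Lemma addrr_F2 (x : F2) : x + x = 0.
Proof. by rewrite -mulr2n -mulr_natr char_Fp_0 // mulr0. Qed.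

(** Vectors in the left kernel of [B] are constant on connected components, so evaluation at one
    root per component, the matrix [Q], is injective on this kernel; rank-nullity gives the
    bound. *)
Lemma rank_invariants (tw tu s : {perm T}) m (B : 'M[F2]_(#|porbits s|, m)) :
  (forall u : 'rV_#|porbits s|, u *m B = 0 ->
     forall x, u 0 (porbit_index s (tw x)) = u 0 (porbit_index s x) /\
               u 0 (porbit_index s (tu x)) = u 0 (porbit_index s x)) ->
  (#|porbits s| <= \rank B + n_comp (map_link tw tu) predT)%N.
Proof.
move=> inv; set e := map_link tw tu.
pose r := roots e.
pose Q : 'M[F2]_(#|porbits s|, #|r|) :=
  \matrix_(i, c) (i == porbit_index s (enum_val c))%:R.
have QE (u : 'rV_#|porbits s|) c : (u *m Q) 0 c = u 0 (porbit_index s (enum_val c)).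
  rewrite mxE (bigD1 (porbit_index s (enum_val c))) //= mxE eqxx mulr1 big1 ?addr0 // => i ni.
  by rewrite mxE (negPf ni) mulr0.
have rk : \rank (kermx B *m Q) = \rank (kermx B).
  apply/mxrank_injP; rewrite -submx0; apply/rV_subP => u.
  rewrite sub_capmx => /andP[/sub_kermxP uB /sub_kermxP uQ].
  suff -> : u = 0 by exact: sub0mx.
  apply/rowP => i; rewrite mxE; have [x ->] := porbit_index_surj i.
  have const y z : connect e y z -> u 0 (porbit_index s z) = u 0 (porbit_index s y).
    case/connectP => p; elim: p y => [|w p IH] y /=; first by move=> _ ->.
    case/andP => reversal_weight pw zl; rewrite (IH _ pw zl).
    by have [? ?] := inv u uB y; case/orP: reversal_weight => /eqP ->.
  rewrite -(const _ _ (connect_root e x)).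
  have rr : fingraph.root e x \in r by apply: roots_root; exact: map_link_sym.
  by have := QE u (enum_rank_in rr (fingraph.root e x)); rewrite uQ mxE enum_rankK_in.
have := rank_leq_col (kermx B *m Q); rewrite rk mxrank_ker leq_subLR.
rewrite addnC; suff -> : n_comp e predT = #|r| by rewrite addnC.
by apply: eq_card => x; rewrite !inE andbT.
Qed.

Lemma sum_porbit_index (s : {perm T}) (u : 'rV[F2]_#|porbits s|) x :
  \sum_i u 0 i * (i == porbit_index s x)%:R = u 0 (porbit_index s x).
Proof.
rewrite (bigD1 (porbit_index s x)) //= eqxx mulr1 big1 ?addr0 // => i ni.
by rewrite (negPf ni) mulr0.
Qed.

(* Coboundaries of functions on faces are cycles; by Euler's formula both spaces
   have dimension F - C. *)
Lemma planar_coloring_perm (tw tu : {perm T}) (h : T -> F2) :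
  involutive tw ->
  (#|porbits tu| + #|porbits (face_perm tw tu)|
     = #|porbits tw| + 2 * n_comp (map_link tw tu) predT)%N ->
  (forall d, h (tw d) = h d) ->
  (forall d, \sum_(x in porbit tu d) h x = 0) ->
  exists col : T -> F2, (forall d, col (face_perm tw tu d) = col d) /\
    (forall d, col d + col (tw d) = h d).
Proof.
move=> twK euler htw hsum; set fa := face_perm tw tu.
(* Row i is the coboundary of face i: it marks the darts of the edges that have this face on exactly
   one side. *)
pose A : 'M[F2]_(#|porbits fa|, #|T|) :=
  \matrix_(i, j) ((i == porbit_index fa (enum_val j))%:R + (i == porbit_index fa (tw (enum_val j)))%:R).
pose P s : 'M[F2]_(#|porbits s|, #|T|) := \matrix_(i, j) (i == porbit_index s (enum_val j))%:R.
have PE s (u : 'rV_#|porbits s|) x : (u *m P s) 0 (enum_rank x) = u 0 (porbit_index s x).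
  rewrite mxE -[RHS]sum_porbit_index; apply: eq_bigr => i _.
  by rewrite mxE enum_rankK.
have AE (u : 'rV_#|porbits fa|) x :
    (u *m A) 0 (enum_rank x) = u 0 (porbit_index fa x) + u 0 (porbit_index fa (tw x)).
  rewrite mxE -[X in X + _]sum_porbit_index -[X in _ + X]sum_porbit_index -big_split.
  by apply: eq_bigr => i _; rewrite mxE enum_rankK mulrDr.
(* Incidence of edges and vertices modulo 2. Its left kernel is the cycle space, and [P tw] spreads
   a function on edges over the darts. *)
pose W := P tw *m (P tu)^T.
have faE x : fa x = (tu^-1)%g (tw x) by rewrite /fa /face_perm permM.
(* The corner between [x] and [tu x] lies on one face, which is to the left of [x] and of the twin
   of [tu x]. *)
have clsfa x : porbit_index fa (tw (tu x)) = porbit_index fa x.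
  by rewrite -[RHS](porbit_index_perm fa) -(porbit_index_perm fa (tw (tu x))) !faE twK permK -faE porbit_index_perm
             -(porbit_index_perm fa x) faE.
have rkA : (#|porbits fa| <= \rank A + n_comp (map_link tw tu) predT)%N.
  apply: rank_invariants => u uA x.
  have tw1 y : u 0 (porbit_index fa (tw y)) = u 0 (porbit_index fa y).
    have := AE u y; rewrite uA mxE => /esym/eqP; rewrite addr_eq0 => /eqP ->.
    by apply/eqP; rewrite -addr_eq0 addrr_F2.
  by split => //; rewrite -tw1 clsfa.
have rkW : (#|porbits tu| <= \rank W + n_comp (map_link tw tu) predT)%N.
  rewrite -mxrank_tr /W trmx_mul trmxK; apply: rank_invariants => u uW x.
  split; last by rewrite porbit_index_perm.
  have := congr1 (fun M : 'rV_ _ => M 0 (porbit_index tw x)) uW.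
  rewrite mulmxA mxE [RHS]mxE.
  have [e|ne] := eqVneq (tw x) x; first by rewrite e.
  rewrite (bigD1 (enum_rank x)) //= (bigD1 (enum_rank (tw x))) /=; last first.
    by rewrite (inj_eq enum_rank_inj).
  rewrite big1 => [|j]; last first.
    rewrite -[j]enum_valK !(inj_eq enum_rank_inj); set y := enum_val j.
    case/andP => yx ytx; rewrite !mxE enum_rankK eq_sym porbit_index_eq.
    suff -> : (y \in porbit tw x) = false by rewrite mulr0.
    apply/negP => /porbitP[k yk]; have: y = x \/ y = tw x.
      rewrite yk; elim: (k) => [|l [] IH]; first by left; rewrite expg0 perm1.
        by right; rewrite expgSr permM IH.
      by left; rewrite expgSr permM IH twK.
    by case=> /eqP; apply/negP.
  rewrite !PE !mxE !enum_rankK eqxx eq_sym porbit_index_eq.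
  rewrite -{2}[tw]expg1 mem_porbit !mulr1 addr0 => /eqP.
  rewrite addr_eq0 => /eqP ->.
  by apply/eqP; rewrite -addr_eq0 addrr_F2.
have sumtr j (X : T -> F2) :
    \sum_(i < #|T|) X (enum_val i) * (P tu)^T i j = \sum_(x | porbit_index tu x == j) X x.
  rewrite [RHS]big_mkcond /= (reindex (@enum_val T T)) /=; last first.
    by exists enum_rank => y _; rewrite ?enum_valK ?enum_rankK.
  by apply: eq_bigr => i _; rewrite !mxE eq_sym; case: eqP; rewrite ?mulr1 ?mulr0.
have factor (u : 'rV_#|T|) : (forall x, u 0 (enum_rank (tw x)) = u 0 (enum_rank x)) ->
    exists v : 'rV_#|porbits tw|, u = v *m P tw.
  move=> inv; have ex i : exists x, i == porbit_index tw x.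
    by have [x ->] := porbit_index_surj i; exists x.
  exists (\row_i u 0 (enum_rank (xchoose (ex i)))).
  apply/rowP => j; rewrite -[j]enum_valK PE mxE; set x := enum_val j.
  have := xchooseP (ex (porbit_index tw x)); rewrite porbit_index_eq porbit_sym.
  case/porbitP => k ->; elim: k => [|k IH]; first by rewrite expg0 perm1.
  by rewrite expgSr permM inv.
(* At a vertex a coboundary is a sum over darts of the face of [x] and the face of [tw x]. Replacing
   [x] by [tu x] in the second half makes it equal to the first, and both cancel modulo 2. *)
have AZ : (A <= kermx W *m P tw)%MS.
  apply/row_subP => i; set u := row i A.
  have uE x : u 0 (enum_rank x) = (i == porbit_index fa x)%:R + (i == porbit_index fa (tw x))%:R.
    by rewrite !mxE enum_rankK.
  have [x|v uv] := factor u; first by rewrite !uE twK addrC.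
  rewrite uv submxMr //; apply/sub_kermxP; rewrite mulmxA -uv.
  apply/rowP => j; rewrite mxE [RHS]mxE.
  under eq_bigr => k _ do rewrite -{1}[k]enum_valK uE.
  rewrite (sumtr j (fun x => (i == porbit_index fa x)%:R + (i == porbit_index fa (tw x))%:R)).
  rewrite big_split /= [X in _ + X](reindex_inj (@perm_inj _ tu)) /=.
  under [X in _ + X]eq_bigr => x _ do rewrite clsfa.
  under [X in _ + X]eq_bigl => x do rewrite porbit_index_perm.
  exact: addrr_F2.
(* The cycle space has rank at most E - (V - C), and A has rank at least F - C; Euler's formula
   makes these numbers equal. *)
have rkZ : (\rank (kermx W *m P tw) <= \rank A)%N.
  apply: leq_trans (mxrankM_maxl _ _) _; rewrite mxrank_ker leq_subLR.
  rewrite -(leq_add2r (n_comp (map_link tw tu) predT)) -(leq_add2r (n_comp (map_link tw tu) predT)).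
  rewrite -addnA addnn -mul2n -euler.
  apply: leq_trans (leq_add rkW rkA) _.
  by rewrite addnACA addnA.
have ZA : (kermx W *m P tw <= A)%MS.
  have := mxrank_leqif_eq AZ => -[le eqr].
  by have := eqr; rewrite eqn_leq le rkZ => /esym /andP[].
have hZ : ((\row_j h (enum_val j) : 'rV_#|T|) <= kermx W *m P tw)%MS.
  set u := (\row_j h (enum_val j) : 'rV_#|T|).
  have uE x : u 0 (enum_rank x) = h x by rewrite mxE enum_rankK.
  have [x|v uv] := factor u; first by rewrite !uE.
  rewrite uv submxMr //; apply/sub_kermxP; rewrite mulmxA -uv.
  apply/rowP => j; rewrite mxE [RHS]mxE.
  under eq_bigr => k _ do rewrite -{1}[k]enum_valK uE.
  rewrite (sumtr j h); have [x ->] := porbit_index_surj j.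
  by under eq_bigl => y do rewrite porbit_index_eq.
have /submxP[u hu] := submx_trans hZ ZA.
exists (fun d => u 0 (porbit_index fa d)); split => d; first by rewrite porbit_index_perm.
by rewrite -AE -hu mxE enum_rankK.
Qed.

End PlanarColoring.

(** * Orientations with given outdegrees and their strands *)

Section Involutions.
Variables (T : finType) (al be : T -> T) (t : T -> bool) (X : {set T}) (p : T).
Hypotheses (alK : involutive al) (beK : involutive be).
Hypotheses (alX : forall x, x \in X -> al x \in X).
Hypotheses (beX : forall x, x \in X -> be x \in X).
Hypotheses (al_t : forall x, x \in X -> t (al x) = ~~ t x).
Hypotheses (be_t : forall x, x \in X -> be x != x -> t (be x) = ~~ t x).
Hypotheses (pX : p \in X) (be_p : be p = p).

Definition closed_under (S : {set T}) :=
  [/\ p \in S, forall x, x \in S -> al x \in S & forall x, x \in S -> be x \in S].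

(** Alternating two involutions splits [X] into paths and cycles, and the fixed points of [be] are
    the ends of the paths. The last two conclusions say that [q] lies in the component of [p] and
    that this component has no further ends. *)
Lemma involution_path_end : exists q,
  [/\ be q = q, t q = ~~ t p, forall S, closed_under S -> q \in S &
      exists2 S, closed_under S & forall x, x \in S -> be x = x -> x = p \/ x = q].
Proof.
pose ga x := al (be x).
have ga_inj : injective ga by exact: inj_comp (inv_inj alK) (inv_inj beK).
have ex : exists k, (0 < k)%N && (be (iter k ga p) == iter k ga p).
  exists (fingraph.order ga p); rewrite fingraph.order_gt0 iter_order //; exact/eqP.
case: (ex_minnP ex) => k /andP[k0 /eqP fixk] mink.
have nofix j : (0 < j < k)%N -> be (iter j ga p) != iter j ga p.
  case/andP=> j0; rewrite ltnNge; apply: contra => fixj.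
  by apply: mink; rewrite j0.
have itX j : iter j ga p \in X by elim: j => //= j IH; apply/alX/beX.
(* Starting at the end [p], only [al] flips [t]; afterwards the flips of [be] and [al] cancel in
   each round. *)
have itt j : (0 < j <= k)%N -> t (iter j ga p) = ~~ t p.
  elim: j => // -[_ _|j IH /andP[_ jk]]; first by rewrite /= /ga be_p al_t.
  have t1 : t (al (be (iter j.+1 ga p))) = ~~ t (be (iter j.+1 ga p)).
    by apply: al_t; apply: beX; exact: itX.
  have t2 : t (be (iter j.+1 ga p)) = ~~ t (iter j.+1 ga p).
    by apply: be_t (itX _) (nofix _ _).
  by rewrite iterS [LHS]t1 t2 negbK; apply: IH; exact: ltnW.
(* [be] conjugates [ga] into its inverse, so it reflects the orbit at its fixed point of index k:
   the walk returns the way it came and closes after 2k steps. *)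
have refl j : (j <= k)%N -> be (iter (k + j) ga p) = iter (k - j) ga p.
  elim: j => [_|j IH jk]; first by rewrite addn0 subn0.
  rewrite addnS iterS {1}/ga IH; last exact: ltnW.
  by rewrite subnS -[(k - j)%N]prednK ?subn_gt0 // iterS {1}/ga alK beK.
have per : iter (k + k) ga p = p.
  by rewrite -[LHS]beK refl // subnn /= be_p.
have refl2 j : (j <= k + k)%N -> be (iter j ga p) = iter (k + k - j) ga p.
  move=> jk; case: (leqP k j) => kj.
    rewrite -{1}(subnKC kj) refl ?leq_subLR //.
    by congr (iter _ _ _); rewrite subnBA // .
  rewrite -[RHS]beK; congr be.
  have -> : (k + k - j = k + (k - j))%N by rewrite addnBA // ltnW.
  by rewrite refl ?leq_subr // subKn // ltnW.
exists (iter k ga p); split => //; first by rewrite itt // k0 /=.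
  move=> S [pS aS bS]; elim: (k) => //= j IH; exact/aS/bS.
pose S := [set iter (val j) ga p | j : 'I_(k + k).+1].
have SP x : x \in S -> exists2 j, (j <= k + k)%N & x = iter j ga p.
  by case/imsetP => -[j jk] _ ->; exists j.
have memS j : (j <= k + k)%N -> iter j ga p \in S.
  by move=> jk; apply/imsetP; exists (@Ordinal (k + k).+1 j jk).
exists S; last first.
  move=> x /SP[j jk ->] fixj.
  have [->|j0] := posnP j; first by left.
  have [jk'|jk'|->] := ltngtP j k; last by right.
    by have := nofix j; rewrite j0 jk' fixj eqxx => /(_ isT).
  have [->|jn] := eqVneq j (k + k)%N; first by left.
  have jlt : (j < k + k)%N by rewrite ltn_neqAle jn.
  have /nofix : (0 < k + k - j < k)%N by rewrite subn_gt0 jlt ltn_subLR // ltn_add2r.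
  by rewrite -refl2 // !fixj eqxx.
split; first exact: (memS 0%N).
  move=> x /SP[j jk ->].
  case: j jk => [_|j jk].
    have := memS 1%N; rewrite /= /ga be_p; apply.
    exact: leq_trans k0 (leq_addr _ _).
  rewrite iterS {2}/ga alK refl2 ?memS ?leq_subr //; exact: ltnW.
move=> x /SP[j jk ->].
by rewrite refl2 ?memS ?leq_subr.
Qed.

End Involutions.

Section Reorient.
Variables (R : realFieldType) (n : nat) (N : network R n).
Implicit Types (d x y e : dart N) (i j p q r s : 'I_n) (O A B X : {set dart N}).
Implicit Types (J : {set 'I_n}).

Local Notation tw := (twin N).
Local Notation lg := (leg N).

Definition reorient J : {set {set dart N}} :=
  [set O : {set dart N} | [&& [forall d, (tw d \in O) == (d \notin O)],
     [forall d, internal d ==> (#|O :&: vtx d| == outdegree d)]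
   & [forall i, (lg i \in O) == (i \in J)]]].

Lemma reorientP J O : reflect
  [/\ forall d, (tw d \in O) = (d \notin O),
      forall d, internal d -> #|O :&: vtx d| = outdegree d
    & forall i, (lg i \in O) = (i \in J)] (O \in reorient J).
Proof.
rewrite inE; apply: (iffP and3P) => -[h1 h2 h3]; split.
- by move=> d; apply/eqP; move/forallP: h1.
- by move=> d di; apply/eqP; move/forallP: h2 => /(_ d); rewrite di.
- by move=> i; apply/eqP; move/forallP: h3.
- by apply/forallP => d; apply/eqP.
- by apply/forallP => d; apply/implyP => /h2 ->.
- by apply/forallP => i; apply/eqP.
Qed.

Lemma reorient_self : [set d : dart N | out d] \in reorient (sources N).
Proof.
apply/reorientP; split=> [d|d _|i]; rewrite ?inE ?out_twin //.
rewrite /outdegree; apply: eq_card => x.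
by rewrite !inE andbC.
Qed.

Definition diff A B := (A :\: B) :|: (B :\: A).

Lemma in_diff A B d : (d \in diff A B) = (d \in A) (+) (d \in B).
Proof. by rewrite !inE; case: (d \in A) (d \in B) => [] []. Qed.

Definition link X : rel (dart N) := fun a b =>
  (b == tw a) || [&& internal a, b \in vtx a, a \in X & b \in X].

Definition strand X p : {set dart N} := [set x | connect (link X) (lg p) x].

Lemma link_sym X : ssrbool.symmetric (link X).
Proof.
move=> a b; rewrite /link; congr orb.
  by apply/eqP/eqP => ->; rewrite twinK.
apply/and4P/and4P => -[h1 h2 h3 h4]; split => //.
- by rewrite (internal_vtx h2).
- by rewrite vtx_sym.
- by rewrite (internal_vtx h2).
- by rewrite vtx_sym.
Qed.

Lemma strand_leg X p : lg p \in strand X p.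
Proof. by rewrite inE. Qed.

Lemma strand_link X p a b : link X a b -> (b \in strand X p) = (a \in strand X p).
Proof.
move=> ab; rewrite !inE; apply/idP/idP => h; apply: connect_trans h (connect1 _) => //.
by rewrite link_sym.
Qed.

Lemma strand_twin X p d : (tw d \in strand X p) = (d \in strand X p).
Proof. by apply: strand_link; rewrite /link eqxx. Qed.

Lemma strand_sub X (S : {set dart N}) p : lg p \in S ->
  (forall a b, a \in S -> link X a b -> b \in S) -> strand X p \subset S.
Proof.
move=> pS cl; apply/subsetP => x; rewrite inE => /connectP[l].
elim: l (lg p) pS => [|z l IH] y yS /=; first by move=> _ ->.
by case/andP => /(cl _ _ yS) zS; apply: IH.
Qed.

Lemma strand_mem_eq X p q x : x \in strand X p -> x \in strand X q -> lg q \in strand X p.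
Proof.
rewrite !inE => px; rewrite (sym_connect_sym (@link_sym X)).
exact: connect_trans.
Qed.

Hypothesis pN : perfect N.

(** Equal outdegrees leave equal numbers once the common part is removed. If the outdegree is 1, A
    has a single outgoing dart there; if the indegree is 1, B leaves a single dart incoming, and it
    contains A minus B. *)
Lemma card_diff_vtx J1 J2 A B d : A \in reorient J1 -> B \in reorient J2 ->
  internal d -> #|(A :\: B) :&: vtx d| = #|(B :\: A) :&: vtx d|
   /\ (#|(A :\: B) :&: vtx d| <= 1)%N.
Proof.
move=> /reorientP[_ hA _] /reorientP[_ hB _] di.
have := hA _ di; rewrite -(hB _ di) -(cardsID B (A :&: _)) -(cardsID A (B :&: _)).
have -> : A :&: vtx d :&: B = B :&: vtx d :&: A.
  by apply/setP => x; rewrite !inE; case: (x \in A); rewrite ?andbF ?andbT //= andbC.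
move/addnI.
have e1 C D : C :&: vtx d :\: D = (C :\: D) :&: vtx d.
  by apply/setP => x; rewrite !inE andbA.
rewrite !e1 => eAB; split=> //.
have [oA|oA] := pN di.
  by rewrite -oA -(hA _ di) subset_leq_card // setSI // subsetDl.
have: (#|vtx d :\: B| = 1)%N.
  rewrite -oA /indegree cardsD setIC (hB _ di) /outdegree.
  rewrite -(cardsID [set x | out x] (vtx d)).
  have -> : vtx d :&: [set x | out x] = [set x in vtx d | out x].
    by apply/setP => x; rewrite !inE.
  by rewrite addKn; apply: eq_card => x; rewrite !inE andbC.
by move <-; apply: subset_leq_card; apply/subsetP => x; rewrite !inE => /andP[/andP[-> _]].
Qed.

(** This makes the difference of two orientations a union of paths and cycles, each coherently
    directed by [A]. *)
Lemma partner J1 J2 A B d : A \in reorient J1 -> B \in reorient J2 ->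
  internal d -> d \in diff A B ->
  exists e, [/\ e != d, vtx d :&: diff A B = [set d; e] & (e \in A) = (d \notin A)].
Proof.
wlog dA : J1 J2 A B / d \in A => [wl hA hB di dX|].
  have [dA|dA] := boolP (d \in A); first by have := wl _ _ _ _ dA hA hB di dX; rewrite dA.
  have dB : d \in B by move: dX; rewrite in_diff (negPf dA).
  have sym : diff B A = diff A B by rewrite /diff setUC.
  have [|e [e1 e2 e3]] := wl _ _ _ _ dB hB hA di; first by rewrite sym.
  exists e; split; rewrite -?sym //.
  have : e \in vtx d :&: diff A B by rewrite -sym e2 !inE eqxx orbT.
  by rewrite inE in_diff e3 dB addbF => /andP[_ ->].
move=> hA hB di; rewrite in_diff dA /= => dB.
have [e1 e2] := card_diff_vtx hA hB di.
have dAB : d \in (A :\: B) :&: vtx d by rewrite !inE dA dB vtx_id.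
have c1 : #|(A :\: B) :&: vtx d| == 1%N.
  by rewrite eqn_leq e2 card_gt0; apply/set0Pn; exists d.
have := c1; rewrite e1 => /cards1P[e eBA].
have /cards1P[d' dd'] := c1.
move: dAB; rewrite dd' inE => /eqP dd; rewrite -{d'}dd in dd'.
have := set11 e; rewrite -eBA !inE => /andP[/andP[eA eB] ev].
exists e; split; rewrite ?(negPf eA) //.
  by apply: contraNneq eA => ->.
by rewrite setIC /diff setIUl dd' eBA.
Qed.

Section Components.
Variables (J1 J2 : {set 'I_n}) (A B : {set dart N}).
Hypotheses (hA : A \in reorient J1) (hB : B \in reorient J2).
Local Notation X := (diff A B).

Lemma twin_diff d : (tw d \in X) = (d \in X).
Proof.
have /reorientP[tA _ _] := hA; have /reorientP[tB _ _] := hB.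
by rewrite !in_diff tA tB; case: (d \in A) (d \in B) => [] [].
Qed.

Lemma strand_diff p : lg p \in X -> strand X p \subset X.
Proof.
move=> pX; apply: strand_sub => // a b aX.
by case/orP => [/eqP ->|/and4P[] //]; rewrite twin_diff.
Qed.

(** Apply [involution_path_end] to [twin] and the partner map, with [t] the direction in [A]. A
    strand is a directed path for [A], hence exactly one of its two ends is a source. *)
Lemma strand_ends p : lg p \in X -> exists q,
  [/\ lg q \in strand X p, (q \in J1) = (p \notin J1) &
      forall r, lg r \in strand X p -> r = p \/ r = q].
Proof.
move=> pX; have /reorientP[tA _ lA] := hA.
pose be d := if internal d && (d \in X) then
    odflt d [pick e in vtx d :&: X | e != d] else d.
have beE d e : internal d -> d \in X -> vtx d :&: X = [set d; e] -> e != d -> be d = e.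
  move=> di dX v ed; rewrite /be di dX /=; case: pickP => [z|/(_ e)] /=.
    by rewrite v !inE => /andP[/orP[] /eqP -> //]; rewrite eqxx.
  by rewrite v !inE eqxx orbT ed.
have beP d : internal d -> d \in X ->
    [/\ be d != d, vtx d :&: X = [set d; be d] & (be d \in A) = (d \notin A)].
  move=> di dX; have [e [e1 e2 e3]] := partner hA hB di dX.
  by rewrite (beE d e di dX e2 e1).
have be0 d : ~~ (internal d && (d \in X)) -> be d = d by rewrite /be => /negPf ->.
have beX d : d \in X -> be d \in X.
  move=> dX; have [di|di] := boolP (internal d); last by rewrite be0 // (negPf di).
  have [_ v _] := beP d di dX; have: be d \in vtx d :&: X by rewrite v !inE eqxx orbT.
  by rewrite inE => /andP[].
have beV d : be d \in vtx d.
  have [/andP[di dX]|/be0 ->] := boolP (internal d && (d \in X)); last exact: vtx_id.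
  have [_ v _] := beP d di dX; have: be d \in vtx d :&: X by rewrite v !inE eqxx orbT.
  by rewrite inE => /andP[].
have beK : involutive be.
  move=> d; have [/andP[di dX]|h] := boolP (internal d && (d \in X)); last by rewrite !be0.
  have [e1 e2 e3] := beP d di dX; apply: beE.
  - by rewrite (internal_vtx (beV d)).
  - exact: beX.
  - by rewrite (vtx_same (beV d)) e2; apply/setP => z; rewrite !inE orbC.
  - by rewrite eq_sym.
have := @involution_path_end _ tw be (fun d => d \in A) X (lg p) (@twinK _ _) beK.
case=> [d dX|d dX|d dX|d dX bd|//||q [q1 q2 q3 [S [pS twS beS] S2]]].
- by rewrite twin_diff.
- exact: beX.
- by rewrite tA.
- have [/andP[di _]|h] := boolP (internal d && (d \in X)); first by case: (beP d di dX).
  by rewrite be0 ?eqxx in bd.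
- by rewrite be0 // internal_leg.
have qC : q \in strand X (p).
  apply: q3; split; first exact: strand_leg.
    by move=> x; rewrite strand_twin.
  move=> x xC; have [/andP[di dX]|/be0 ->//] := boolP (internal x && (x \in X)).
  by rewrite (@strand_link _ _ x) // /link di beV dX beX ?orbT.
have qX : q \in X by have /subsetP := strand_diff pX; apply.
have /internalPn[i qi] : ~~ internal q.
  by apply/negP => qint; have [] := beP q qint qX; rewrite q1 eqxx.
have CS : strand X p \subset S.
  apply: strand_sub => // a b aS /orP[/eqP ->|/and4P[ai ba aX bX]]; first exact: twS.
  have [_ v _] := beP a ai aX.
  have: b \in vtx a :&: X by rewrite inE ba.
  by rewrite v !inE => /orP[] /eqP ->; rewrite ?beS.
exists i; rewrite -qi -!lA -qi; split => // r rC.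
have [||] := S2 (lg r) (subsetP CS _ rC).
- by rewrite be0 ?internal_leg.
- by move/(@dm_leg_inj _ N); left.
by rewrite qi => /(@dm_leg_inj _ N); right.
Qed.

End Components.
End Reorient.

Section Legs.
Variables (n : nat) (G : disk_map n).

Lemma porbit_leg (i j : 'I_n) : leg G j \in porbit (turn G) (leg G i).
Proof.
have it k : (turn G ^+ k)%g (leg G i) = leg G (iter k (@ordS n) i).
  elim: k => [|k IH]; first by rewrite expg0 perm1.
  by rewrite expgSr permM IH dm_turn_leg.
(* Adding n - i instead of subtracting i keeps the exponent a natural number. *)
have -> : leg G j = (turn G ^+ (j + (n - i)))%g (leg G i).
  rewrite it; congr (leg G _); apply: val_inj.
  have itv k : val (iter k (@ordS n) i) = ((i + k) %% n)%N.
    elim: k => [|k IH] /=; first by rewrite addn0 modn_small.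
    by rewrite IH -addn1 modnDml addn1 addnS.
  by rewrite itv addnCA subnKC ?modnDr ?modn_small // ltnW.
exact: mem_porbit.
Qed.

End Legs.

(** * Strands do not cross *)

Section Noncrossing.
Variables (R : realFieldType) (n : nat) (N : network R n).
Hypothesis pN : perfect N.
Variables (J1 J2 : {set 'I_n}) (A B : {set dart N}).
Hypotheses (hA : A \in reorient N J1) (hB : B \in reorient N J2).
Local Notation tw := (twin N).
Local Notation lg := (leg N).
Local Notation X := (diff A B).
Implicit Types (p q r s i : 'I_n) (d : dart N).

(* Over F_2 the strand joining [p] to [r], closed up through the boundary
   point, is the boundary of a set of faces: [col] indicates this set.  It is
   constant along the strand joining [q] to [s], but changes when the
   boundary circle passes [r]. *)
Lemma noncrossing p q r s : (p < q)%N -> (q < r)%N -> (r < s)%N ->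
  lg p \in X -> lg q \in X -> lg r \in strand X p -> lg s \in strand X q -> False.
Proof.
move=> pq qr rs pX qX rp sq; set H := strand X p.
have HX : H \subset X := strand_diff hA hB pX.
have legH i : lg i \in H -> i = p \/ i = r.
  have [e [_ _ ends]] := strand_ends pN hA hB pX.
  have [rp'|re] := ends r rp; last by rewrite re; exact: ends.
  by move: (ltn_trans pq qr); rewrite rp' ltnn.
have qH : lg q \notin H.
  by apply/negP => /legH [] e; move: pq qr; rewrite e ltnn.
have disj a : a \in strand X q -> a \notin H.
  by move=> aq; apply: contra qH => aH; apply: strand_mem_eq aH aq.
have vtxH a e : internal a -> a \in X -> e \in vtx a -> e \in H -> a \in H.
  move=> ai aX ea eH; rewrite /H (@strand_link _ _ _ X p e) //.
  by rewrite /link (internal_vtx ea) ai vtx_sym ea (subsetP HX _ eH) aX orbT.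
(* A strand has either no dart at an internal vertex or a dart together with its partner. *)
have even_int d : internal d -> \sum_(x in porbit (turn N) d) ((x \in H)%:R : 'F_2) = 0.
  move=> di; have vd : vtx d = porbit (turn N) d by rewrite /vtx di.
  have [/existsP[a /andP[av aH]]|/existsPn none] := boolP [exists a, (a \in vtx d) && (a \in H)].
    have ai : internal a by rewrite (internal_vtx av).
    have aX := subsetP HX _ aH.
    have [e [ea v _]] := partner pN hA hB ai aX.
    have : e \in vtx a :&: X by rewrite v !inE eqxx orbT.
    rewrite inE => /andP[ev eX].
    rewrite -vd -(vtx_same av) (bigD1 a) ?vtx_id //= (bigD1 e) /=; last by rewrite ev.
    rewrite aH (vtxH e a) //.
    - rewrite big1 => [|x /andP[/andP[xv xa] xe]]; first by rewrite addr0 addrr_F2.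
      have [xH|//] := boolP (x \in H).
      have : x \in vtx a :&: X by rewrite inE xv (subsetP HX).
      by rewrite v !inE (negPf xa) (negPf xe).
    - by rewrite (internal_vtx ev).
    by rewrite vtx_sym.
  rewrite big1 // => x; rewrite -vd => xv.
  by have := none x; rewrite xv /= => /negPf ->.
have even_leg i : \sum_(x in porbit (turn N) (lg i)) ((x \in H)%:R : 'F_2) = 0.
  rewrite (bigD1 (lg p)) ?porbit_leg //= (bigD1 (lg r)) /=; last first.
    rewrite porbit_leg /= (inj_eq (@dm_leg_inj _ N)).
    by apply/eqP => e; move: (ltn_trans pq qr); rewrite e ltnn.
  rewrite strand_leg rp big1 => [|x /andP[/andP[xl xp] xr]]; first by rewrite addr0 addrr_F2.
  have : ~~ internal x by rewrite (internal_porbit xl) internal_leg.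
  case/internalPn => j xj; move: xp xr; rewrite xj => xp xr.
  by have [/legH [] e|//] := boolP (lg j \in H); move: xp xr; rewrite e eqxx.
have [|d|d|col [colf colt]] :=
    @planar_coloring_perm _ (twin N) (turn N) (fun x => (x \in H)%:R) (@twinK _ _).
- exact: dm_planar.
- by rewrite strand_twin.
- by have [/even_int //|/internalPn[i ->]] := boolP (internal d).
(* The faces to the left of [d] and of the twin of [turn N d] coincide, so turning past a dart
   changes the color exactly when that dart is in [H]. *)
have colT d : col (turn N d) = col d + (turn N d \in H)%:R.
  have e : col (tw (turn N d)) = col d by rewrite -colf /face_perm permM twinK permK.
  by rewrite -colt e addrCA addrr_F2 addr0.
(* By [vtxH], a vertex where the other strand passes carries no dart of [H], so turning around it
   keeps the color. *)
have colX a b : a \in strand X q -> link X a b -> col b = col a.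
  move=> aq /orP[/eqP ->|/and4P[ai ba aX bX]].
    have := colt a; rewrite (negPf (disj a aq)) => /eqP; rewrite addr_eq0 => /eqP ->.
    by apply/eqP; rewrite -addr_eq0 addrr_F2.
  have : b \in porbit (turn N) a by move: ba; rewrite /vtx ai.
  case/porbitP => k ->; elim: k => [|k IH]; first by rewrite expg0 perm1.
  rewrite expgSr permM colT IH; set z := turn N _.
  have [zH|_] := boolP (z \in H); last by rewrite addr0.
  have: a \in H.
    apply: vtxH zH => //; rewrite /vtx ai.
    by have := mem_porbit (turn N) k.+1 a; rewrite expgSr permM.
  by move: (disj a aq) => /negPf ->.
have colq : col (lg s) = col (lg q).
  have : strand X q \subset [set x | (x \in strand X q) && (col x == col (lg q))].
    apply: strand_sub => [|a b]; first by rewrite inE strand_leg eqxx.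
    rewrite !inE -/(a \in _) => /andP[aq /eqP <-] ab.
    have aq' : a \in strand X q by rewrite inE.
    have := strand_link q ab; rewrite aq' inE => ->.
    by rewrite (colX _ _ aq' ab) eqxx.
  by move/subsetP/(_ _ sq); rewrite inE => /andP[_ /eqP].
have step i (j : 'I_n) : (i < j)%N -> (forall x : 'I_n, (i < x <= j)%N -> lg x \notin H) ->
    col (lg j) = col (lg i).
  move=> ij; have [m] := ubnPeq (j - i)%N; elim: m j ij => [|m IH] j ij.
    by rewrite subn_eq0 leqNgt ij.
  move=> /eqP jm nH.
  have j0 : (0 < j)%N by exact: leq_ltn_trans ij.
  have pj : val (ord_pred j) = j.-1.
    by rewrite /= -subn1 -addnBAC // subn1 modnDr modn_small // (leq_ltn_trans (leq_pred _)).
  have cj : col (lg j) = col (lg (ord_pred j)).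
    rewrite -{1}[j]ord_predK -dm_turn_leg colT dm_turn_leg ord_predK.
    by rewrite (negPf (nH j _)) ?addr0 // ij leqnn.
  have [ie|ne] := eqVneq i (ord_pred j); first by rewrite ie.
  have ij' : (i < ord_pred j)%N.
    by rewrite ltn_neqAle ne pj -ltnS prednK.
  rewrite cj; apply: IH => //.
    by rewrite pj -subn1 subnAC jm subn1.
  move=> x /andP[ix]; rewrite pj => xj.
  by apply: nH; rewrite ix (leq_trans xj) // leq_pred.
have cr : col (lg r) = col (lg (ord_pred r)) + 1.
  by rewrite -{1}[r]ord_predK -dm_turn_leg colT dm_turn_leg ord_predK rp.
have r0 : (0 < r)%N by exact: leq_ltn_trans qr.
have pr : val (ord_pred r) = r.-1.
  by rewrite /= -subn1 -addnBAC // subn1 modnDr modn_small // (leq_ltn_trans (leq_pred _)).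
have cs : col (lg s) = col (lg r).
  apply: step rs _ => x /andP[rx _]; apply/negP => /legH [] e; move: rx; rewrite e ?ltnn //.
  by rewrite ltnNge ltnW // (ltn_trans pq).
have cq : col (lg (ord_pred r)) = col (lg q).
  have [->//|ne] := eqVneq q (ord_pred r).
  apply: step; first by rewrite ltn_neqAle ne pr -ltnS prednK.
  move=> x /andP[qx]; rewrite pr => xr; apply/negP => /legH [] e; move: qx xr; rewrite e.
    by rewrite ltnNge ltnW.
  by move=> _; rewrite leqNgt ltn_predL r0.
have := cs; rewrite colq cr cq => /eqP.
by rewrite eq_sym -subr_eq0 addrAC subrr add0r oner_eq0.
Qed.

End Noncrossing.

(** * Exchange along strands and the three-term relations for orientation sums *)

Section Exchange.
Variables (R : realFieldType) (n : nat) (N : network R n).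
Hypothesis pN : perfect N.
Local Notation tw := (twin N).
Local Notation lg := (leg N).
Implicit Types (p q r s i : 'I_n) (d : dart N) (A B P : {set dart N}) (J K : {set 'I_n}).

Definition exchange P A B := (A :\: P) :|: (B :&: P).

Lemma in_exchange P A B d : (d \in exchange P A B) = if d \in P then d \in B else d \in A.
Proof. by rewrite !inE; case: (d \in P); rewrite /= ?andbT ?andbF ?orbF. Qed.

Lemma diff_exchange P A B : diff (exchange P A B) (exchange P B A) = diff A B.
Proof.
by apply/setP => d; rewrite !in_diff !in_exchange; case: ifP => // _; rewrite addbC.
Qed.

Lemma exchangeK P A B : exchange P (exchange P A B) (exchange P B A) = A.
Proof. by apply/setP => d; rewrite !in_exchange; case: ifP => // ->. Qed.

Section Reoriented.
Variables (J1 J2 : {set 'I_n}) (A B : {set dart N}).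
Hypotheses (hA : A \in reorient N J1) (hB : B \in reorient N J2).
Local Notation X := (diff A B).

Lemma leg_diff i : (lg i \in X) = (i \in J1) (+) (i \in J2).
Proof.
by have /reorientP[_ _ lA] := hA; have /reorientP[_ _ lB] := hB; rewrite in_diff lA lB.
Qed.

(** Darts of the difference at an internal vertex are linked, so a strand has all of them or none.
    The exchanged orientation therefore agrees with [B] or with [A] on the whole vertex and keeps
    its outdegree. *)
Lemma exchange_reorient p J : lg p \in X ->
  (forall i, (i \in J) = if lg i \in strand X p then i \in J2 else i \in J1) ->
  exchange (strand X p) A B \in reorient N J.
Proof.
move=> pX JE; have /reorientP[tA oA lA] := hA; have /reorientP[tB oB lB] := hB.
apply/reorientP; split => [d|d di|i].
- by rewrite !in_exchange strand_twin tA tB; case: ifP.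
- have [/existsP[a /andP[av aP]]|/existsPn none] :=
    boolP [exists a, (a \in vtx d) && (a \in strand X p)].
    rewrite -(oB d di); apply: eq_card => x; rewrite !in_setI in_exchange.
    have [xv|_] := boolP (x \in vtx d); last by rewrite !andbF.
    case: ifP => // xP; congr andb.
    have : x \notin X.
      apply: contraFN xP => xX; rewrite (@strand_link _ _ _ X p a) //.
      rewrite /link (internal_vtx av) di (vtx_same av) xv xX.
      by rewrite (subsetP (strand_diff hA hB pX)) ?orbT.
    by rewrite in_diff; case: (x \in A) (x \in B) => [] [].
  rewrite -(oA d di); apply: eq_card => x; rewrite !in_setI in_exchange.
  have := none x; case: (x \in vtx d); rewrite ?andbF //=.
  by move/negPf => ->.
- by rewrite in_exchange lA lB JE.
Qed.

Lemma exchange_ends p q J : lg p \in X -> lg q \in strand X p -> p != q ->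
  (forall i, (i \in J) = if (i == p) || (i == q) then i \in J2 else i \in J1) ->
  exchange (strand X p) A B \in reorient N J.
Proof.
move=> pX qP pq JE; apply: exchange_reorient => // i; rewrite JE.
suff -> : (lg i \in strand X p) = (i == p) || (i == q) by [].
have [e [_ _ ends]] := strand_ends pN hA hB pX.
have [qp|qe] := ends q qP; first by rewrite qp eqxx in pq.
apply/idP/orP => [/ends []->|[] /eqP ->//]; rewrite ?qe ?eqxx; [by left|by right|].
exact: strand_leg.
Qed.

(** One step from [J1] towards [J2] that stays among the source sets of orientations. *)
Lemma source_exchange p : p \in J1 -> p \notin J2 -> exists q,
  [/\ q \in J2, q \notin J1 & exists C, C \in reorient N (q |: (J1 :\ p))].
Proof.
move=> p1 p2; have pX : lg p \in X by rewrite leg_diff p1.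
have [q [qP qE ends]] := strand_ends pN hA hB pX.
have q1 : q \notin J1 by rewrite qE p1.
have qX : lg q \in X by rewrite (subsetP (strand_diff hA hB pX)).
have q2 : q \in J2 by move: qX; rewrite leg_diff (negPf q1).
have pq : p != q by apply: contraNneq q1 => <-.
exists q; split => //; exists (exchange (strand X p) A B).
apply: (exchange_ends pX qP pq) => i; rewrite !inE.
have [->|iq] := eqVneq i q; first by rewrite orbT.
by have [->|ip] := eqVneq i p; rewrite ?(negPf p2).
Qed.

Lemma sink_exchange p : p \in J2 -> p \notin J1 -> exists q, q \in J1 /\ q \notin J2.
Proof.
move=> p2 p1; have pX : lg p \in X by rewrite leg_diff p2 (negPf p1).
have [q [qP qE ends]] := strand_ends pN hA hB pX.
have q1 : q \in J1 by rewrite qE p1.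
exists q; split => //.
have := subsetP (strand_diff hA hB pX) _ qP.
by rewrite leg_diff q1.
Qed.

End Reoriented.

Variables (y : dart N -> R).

Definition orient_weight A := \prod_(d in A) y d.
Definition orient_sum J := \sum_(A in reorient N J) orient_weight A.

Lemma orient_weight_exchange P A B : orient_weight (exchange P A B) * orient_weight (exchange P B A) = orient_weight A * orient_weight B.
Proof.
rewrite /orient_weight ![\prod_(d in _) _]big_mkcond -!big_split /=; apply: eq_bigr => d _.
by rewrite !in_exchange; case: (d \in P) => //; rewrite mulrC.
Qed.

Definition flip_pair p (x : {set dart N} * {set dart N}) :=
  let P := strand (diff x.1 x.2) p in (exchange P x.1 x.2, exchange P x.2 x.1).

(** The strand depends only on the symmetric difference, which the exchange leaves unchanged. *)
Lemma flip_pairK p : involutive (flip_pair p).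
Proof. by case=> A B; rewrite /flip_pair /= diff_exchange !exchangeK. Qed.

Definition pairs J1 J2 := [pred x | (x.1 \in reorient N J1) && (x.2 \in reorient N J2)].

Lemma orient_sumM J1 J2 : orient_sum J1 * orient_sum J2 = \sum_(x in pairs J1 J2) orient_weight x.1 * orient_weight x.2.
Proof. by rewrite /orient_sum big_distrlr /= pair_big. Qed.

Lemma flip_pairs p q A B (J1 J2 J1' J2' : {set 'I_n}) : (A, B) \in pairs J1 J2 ->
  (p \in J1) (+) (p \in J2) -> lg q \in strand (diff A B) p -> p != q ->
  (forall i, (i \in J1') = if (i == p) || (i == q) then i \in J2 else i \in J1) ->
  (forall i, (i \in J2') = if (i == p) || (i == q) then i \in J1 else i \in J2) ->
  flip_pair p (A, B) \in pairs J1' J2'.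
Proof.
case/andP => /= hA hB pJ qP pq h1 h2.
have sym : diff A B = diff B A by rewrite /diff setUC.
rewrite inE /flip_pair /=; apply/andP; split.
  by apply: (exchange_ends hA hB _ qP pq) => //; rewrite (leg_diff hA hB).
rewrite sym; apply: (exchange_ends hB hA _ _ pq) => //; last by rewrite -sym.
by rewrite (leg_diff hB hA) addbC.
Qed.

(** In a pair with sources p, r and q, s, the strand at p is directed from a source to a sink of the
    first orientation, so it ends at q or s; exchanging along it gives a pair for one of the
    products on the right. Conversely, a strand at p in such a pair could end otherwise only at r,
    which would make it cross the strand from q to s. *)
Lemma orient_sum_three_term K p q r s : (p < q)%N -> (q < r)%N -> (r < s)%N ->
  p \notin K -> q \notin K -> r \notin K -> s \notin K ->
  orient_sum (p |: (r |: K)) * orient_sum (q |: (s |: K)) =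
  orient_sum (p |: (q |: K)) * orient_sum (r |: (s |: K)) + orient_sum (p |: (s |: K)) * orient_sum (q |: (r |: K)).
Proof.
move=> pq qr rs pK qK rK sK.
have nelt i (j : 'I_n) : (i < j)%N -> i != j :> 'I_n.
  by move=> ij; apply/eqP => e; rewrite e ltnn in ij.
have npq := nelt _ _ pq; have nqr := nelt _ _ qr; have nrs := nelt _ _ rs.
have npr := nelt _ _ (ltn_trans pq qr); have nqs := nelt _ _ (ltn_trans qr rs).
have nps := nelt _ _ (ltn_trans pq (ltn_trans qr rs)).
have ne := (negPf npq, negPf nqr, negPf nrs, negPf npr, negPf nqs, negPf nps).
have ne' : ((q == p) = false) * ((r == q) = false) * ((s == r) = false) *
    ((r == p) = false) * ((s == q) = false) * ((s == p) = false).
  by do !split; rewrite eq_sym !ne.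
have nK := (negPf pK, negPf qK, negPf rK, negPf sK).
(* The factors are ordered so that the first one belongs to the orientation obtained from the first
   one of the pair. *)
rewrite [orient_sum (p |: (q |: K)) * _]mulrC [orient_sum (p |: (s |: K)) * _]mulrC !orient_sumM.
rewrite (bigID (fun x => lg q \in strand (diff x.1 x.2) p)) /= addrC.
have key J1 J2 (c : pred ({set dart N} * {set dart N})) :
    (forall x, x \in pairs (p |: (r |: K)) (q |: (s |: K)) -> c x ->
       flip_pair p x \in pairs J1 J2) ->
    (forall x, x \in pairs J1 J2 ->
       flip_pair p x \in pairs (p |: (r |: K)) (q |: (s |: K)) /\ c (flip_pair p x)) ->
    \sum_(x in pairs (p |: (r |: K)) (q |: (s |: K)) | c x) orient_weight x.1 * orient_weight x.2 =
    \sum_(x in pairs J1 J2) orient_weight x.1 * orient_weight x.2.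
  move=> h1 h2; rewrite (reindex_inj (inv_inj (@flip_pairK p))) /=.
  apply: eq_big => [x|x _]; last by rewrite /flip_pair /= orient_weight_exchange.
  apply/andP/idP => [[h c']|/h2 []//].
  by have := h1 _ h c'; rewrite flip_pairK.
have mem4 : (p \in [:: p; q; r; s]) * (q \in [:: p; q; r; s]) *
    (r \in [:: p; q; r; s]) * (s \in [:: p; q; r; s]).
  by rewrite !inE !eqxx !orbT.
have out4 i : i \notin [:: p; q; r; s] ->
    ((i == p) = false) * ((i == q) = false) * ((i == r) = false) * ((i == s) = false).
  by rewrite !inE !negb_or => /and4P[/negPf -> /negPf -> /negPf -> /negPf ->].
(* If p is joined to r, then q has only s left as its other end, contrary to [noncrossing]. *)
have nocross J1 J2 A B (hA : A \in reorient N J1) (hB : B \in reorient N J2) :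
    (forall i, lg i \in diff A B -> i \in [:: p; q; r; s]) ->
    lg p \in diff A B -> lg q \in diff A B -> lg r \in strand (diff A B) p -> False.
  move=> X4 pX qX rP.
  have [e [eP eJ ends]] := strand_ends pN hA hB pX.
  have er : e = r by have [rp|//] := ends r rP; move: npr; rewrite rp eqxx.
  have nqP : lg q \notin strand (diff A B) p.
    apply/negP => /ends; rewrite er => -[] /eqP; by rewrite ?ne ?ne'.
  have [f [fP fJ _]] := strand_ends pN hA hB qX.
  have := X4 _ (subsetP (strand_diff hA hB qX) _ fP).
  rewrite !inE => /or4P[] /eqP fE; rewrite fE in fP fJ.
  - by move/negP: nqP; apply; apply: strand_mem_eq fP; exact: strand_leg.
  - by move: fJ; case: (q \in J1).
  - by move/negP: nqP; apply; apply: strand_mem_eq fP.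
  exact: (noncrossing pN hA hB pq qr rs pX qX rP fP).
have cases4 (J1 J2 J' : {set 'I_n}) a b : a \in [:: p; q; r; s] -> b \in [:: p; q; r; s] ->
    (forall i, i \notin [:: p; q; r; s] -> (i \in J') = (i \in J1)) ->
    all (fun i => (i \in J') == if (i == a) || (i == b) then i \in J2 else i \in J1)
      [:: p; q; r; s] ->
    forall i, (i \in J') = if (i == a) || (i == b) then i \in J2 else i \in J1.
  move=> aI bI h' /allP h i; have [/h /eqP //|iI] := boolP (i \in [:: p; q; r; s]).
  case: ifP => [|_]; last exact: h'.
  by case/orP => /eqP ia; rewrite ia ?aI ?bI in iI.
congr (_ + _); apply: key => -[A B].
- move=> xJ nq; have /andP[/= hA hB] := xJ.
  have pX : lg p \in diff A B by rewrite (leg_diff hA hB) !inE eqxx !ne nK.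
  have [e [eP eJ _]] := strand_ends pN hA hB pX.
  have eX := subsetP (strand_diff hA hB pX) _ eP.
  have es : e = s.
    move: eX eJ; rewrite (leg_diff hA hB) !inE eqxx /=.
    have [e_q|_] := eqVneq e q; first by rewrite -e_q /= eP in nq.
    have [//|_] := eqVneq e s.
    have [//|_] := eqVneq e p.
    by case: (e == r) (e \in K) => [] [].
  rewrite es in eP.
  apply: (flip_pairs xJ _ eP nps); first by rewrite !inE eqxx !ne nK.
    by apply: cases4 => [||i /out4 o|]; rewrite ?mem4 //= !inE ?o ?eqxx ?ne ?ne' ?nK.
  by apply: cases4 => [||i /out4 o|]; rewrite ?mem4 //= !inE ?o ?eqxx ?ne ?ne' ?nK.
- move=> xJ; have /andP[/= hA hB] := xJ.
  have X4 i : lg i \in diff A B -> i \in [:: p; q; r; s].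
    apply: contraTT => /out4 o; rewrite (leg_diff hA hB) !inE !o.
    by case: (i \in K).
  have pX : lg p \in diff A B by rewrite (leg_diff hA hB) !inE eqxx !ne nK.
  have qX : lg q \in diff A B by rewrite (leg_diff hA hB) !inE eqxx !ne !ne' !nK.
  have [e [eP eJ ends]] := strand_ends pN hA hB pX.
  have eX := X4 _ (subsetP (strand_diff hA hB pX) _ eP).
  have es : e = s.
    move: eX eJ; rewrite !inE => /or4P[] /eqP eE; rewrite eE ?eqxx ?ne ?ne' ?nK //.
    by rewrite eE in eP; case: (nocross _ _ _ _ hA hB X4 pX qX eP).
  rewrite es in eP ends; split.
    apply: (flip_pairs xJ _ eP nps); first by rewrite !inE eqxx !ne nK.
      by apply: cases4 => [||i /out4 o|]; rewrite ?mem4 //= !inE ?o ?eqxx ?ne ?ne' ?nK.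
    by apply: cases4 => [||i /out4 o|]; rewrite ?mem4 //= !inE ?o ?eqxx ?ne ?ne' ?nK.
  rewrite /flip_pair /= diff_exchange; apply/negP => /ends [] eE; move: ne'; rewrite eE ?eqxx.
    by case; do 5?case.
  by move: nqs; rewrite eE eqxx.
- move=> xJ qP; have /andP[/= hA hB] := xJ.
  apply: (flip_pairs xJ _ qP npq); first by rewrite !inE eqxx !ne nK.
    by apply: cases4 => [||i /out4 o|]; rewrite ?mem4 //= !inE ?o ?eqxx ?ne ?ne' ?nK.
  by apply: cases4 => [||i /out4 o|]; rewrite ?mem4 //= !inE ?o ?eqxx ?ne ?ne' ?nK.
- move=> xJ; have /andP[/= hA hB] := xJ.
  have X4 i : lg i \in diff A B -> i \in [:: p; q; r; s].
    apply: contraTT => /out4 o; rewrite (leg_diff hA hB) !inE !o.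
    by case: (i \in K).
  have pX : lg p \in diff A B by rewrite (leg_diff hA hB) !inE eqxx !ne nK.
  have qX : lg q \in diff A B by rewrite (leg_diff hA hB) !inE eqxx !ne !ne' !nK.
  have [e [eP eJ ends]] := strand_ends pN hA hB pX.
  have eX := X4 _ (subsetP (strand_diff hA hB pX) _ eP).
  have es : e = q.
    move: eX eJ; rewrite !inE => /or4P[] /eqP eE; rewrite eE ?eqxx ?ne ?ne' ?nK //.
    by rewrite eE in eP; case: (nocross _ _ _ _ hA hB X4 pX qX eP).
  rewrite es in eP; split; last by rewrite /flip_pair /= diff_exchange.
  apply: (flip_pairs xJ _ eP npq); first by rewrite !inE eqxx !ne nK.
    by apply: cases4 => [||i /out4 o|]; rewrite ?mem4 //= !inE ?o ?eqxx ?ne ?ne' ?nK.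
  by apply: cases4 => [||i /out4 o|]; rewrite ?mem4 //= !inE ?o ?eqxx ?ne ?ne' ?nK.
Qed.

End Exchange.

(** * Plucker coordinates *)

Section Plucker.
Variable (R : realFieldType).

(* Its sign is that of the permutation sorting the values of [f], which relates
   the minor with columns listed by [f] to the Plucker coordinate. *)
Definition vdm m n (f : 'I_m -> 'I_n) : R :=
  \det (Vandermonde m (\row_j (f j)%:R)).

Lemma det_colsub_perm m n (M : 'M[R]_(m, n)) (g : 'I_m -> 'I_n) (s : {perm 'I_m}) :
  \det (colsub (g \o s) M) = (-1) ^+ s * \det (colsub g M).
Proof.
have -> : colsub (g \o s) M = col_perm s (colsub g M) by apply/matrixP => i j; rewrite !mxE.
by rewrite col_permE det_mulmx det_perm odd_permV mulrC.
Qed.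

Lemma vdm_perm m n (g : 'I_m -> 'I_n) (s : {perm 'I_m}) :
  vdm (g \o s) = (-1) ^+ s * vdm g.
Proof.
have vE f : vdm f = \det (colsub f (Vandermonde m (\row_(j < n) (j%:R : R)))).
  by congr (\det _); apply/matrixP => i j; rewrite !mxE.
by rewrite !vE det_colsub_perm.
Qed.

Lemma vdm_gt0 m n (g : 'I_m -> 'I_n) : {homo g : i j / (i < j)%N} -> 0 < vdm g.
Proof.
move=> gm; rewrite /vdm det_Vandermonde; apply: prodr_gt0 => i _.
by apply: prodr_gt0 => j ij; rewrite !mxE subr_gt0 ltr_nat gm.
Qed.

Lemma enum_val_ltn n (J : {set 'I_n}) : {homo (@enum_val _ J) : i j / (i < j)%N}.
Proof.
move=> i j ij; have x0 := enum_val i; rewrite !(enum_val_nth x0).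
have : sorted ltn (map val (enum J)).
  have -> : map val (enum J) = [seq k <- iota 0 n | k \in map val (enum J)].
    rewrite -val_enum_ord filter_map; congr map.
    rewrite {1}/enum_mem -enumT; apply: eq_in_filter => x _ /=.
    by rewrite (mem_map val_inj) mem_enum.
  apply: sorted_filter. exact: ltn_trans. exact: iota_ltn_sorted.
move/(sorted_ltn_nth ltn_trans (val x0)) => /(_ i j).
rewrite !inE size_map -cardE => /(_ (ltn_ord i) (ltn_ord j) ij).
by rewrite !(nth_map x0) -?cardE.
Qed.

Lemma same_image_perm m n (f g : 'I_m -> 'I_n) : injective f -> injective g ->
  [set f c | c : 'I_m] = [set g c | c : 'I_m] -> exists s : {perm 'I_m}, f =1 g \o s.
Proof.
move=> fi gi fg.
have ex c : exists b, f c == g b.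
  have : f c \in [set g c | c : 'I_m] by rewrite -fg imset_f.
  by case/imsetP => b _ ->; exists b.
have si : injective (fun c => xchoose (ex c)).
  by move=> a b e; apply: fi; rewrite (eqP (xchooseP (ex a))) e -(eqP (xchooseP (ex b))).
by exists (perm si) => c; rewrite /= permE; apply/eqP/(xchooseP (ex c)).
Qed.

Lemma eq_colsub m n (M : 'M[R]_(m, n)) (f g : 'I_m -> 'I_n) : f =1 g -> colsub f M = colsub g M.
Proof. by move=> fg; apply/matrixP => i j; rewrite !mxE fg. Qed.

Lemma eq_vdm m n (f g : 'I_m -> 'I_n) : f =1 g -> vdm f = vdm g.
Proof. by move=> fg; congr (\det _); apply/matrixP => i j; rewrite !mxE fg. Qed.

Definition enumf k n (J : {set 'I_n}) (hJ : #|J| = k) (c : 'I_k) : 'I_n :=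
  enum_val (cast_ord (esym hJ) c).

Lemma enumf_inj k n (J : {set 'I_n}) (hJ : #|J| = k) : injective (enumf hJ).
Proof. by move=> a b /enum_val_inj /cast_ord_inj. Qed.

Lemma enumf_im k n (J : {set 'I_n}) (hJ : #|J| = k) : [set enumf hJ c | c : 'I_k] = J.
Proof.
apply/setP => x; apply/imsetP/idP => [[c _ ->]|xJ]; first exact: enum_valP.
exists (cast_ord hJ (enum_rank_in xJ x)) => //.
by rewrite /enumf cast_ordK enum_rankK_in.
Qed.

Lemma vdm_enumf_gt0 k n (J : {set 'I_n}) (hJ : #|J| = k) : 0 < vdm (enumf hJ).
Proof. by apply: vdm_gt0 => i j ij; apply: enum_val_ltn. Qed.

Lemma vdm_neq0 m n (f : 'I_m -> 'I_n) : injective f -> vdm f != 0.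
Proof.
move=> fi; have hJ : #|[set f c | c : 'I_m]| = m by rewrite card_imset // card_ord.
have [s fs] := same_image_perm fi (@enumf_inj _ _ _ hJ) (esym (enumf_im hJ)).
by rewrite (eq_vdm fs) vdm_perm mulf_neq0 ?signr_eq0 // gt_eqF // vdm_enumf_gt0.
Qed.

Lemma sg_vdm_sqr m n (f : 'I_m -> 'I_n) : injective f -> Num.sg (vdm f) * Num.sg (vdm f) = 1.
Proof. by move=> /vdm_neq0 h; rewrite -expr2 sqr_sg h. Qed.

Section Subspace.
Variables (k n : nat).
Implicit Types (X : grassmannian R k n) (I J K : {set 'I_n}) (f g : 'I_k -> 'I_n).

Definition basis_mx X : 'M[R]_(k, n) := \matrix_(a, c) (vbasis (val X))`_a 0 c.

(** Sorting the columns changes the minor and the Vandermonde determinant by the same sign, and the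
    sorted Vandermonde determinant is positive. *)
Lemma plucker_det X f : injective f ->
  plucker X [set f c | c : 'I_k] = Num.sg (vdm f) * \det (colsub f (basis_mx X)).
Proof.
move=> fi; have hJ : #|[set f c | c : 'I_k]| = k by rewrite card_imset // card_ord.
have [s fs] := same_image_perm fi (@enumf_inj _ _ _ hJ) (esym (enumf_im hJ)).
rewrite (eq_vdm fs) (eq_colsub _ fs) vdm_perm det_colsub_perm sgrM sgrX sgrN1.
rewrite [X in _ * X * _]gtr0_sg ?vdm_enumf_gt0 // mulr1 signrMK.
(* The basis tuple is indexed by the dimension and the minor by the cardinal of J; generalising both
   allows k to be replaced by that cardinal. *)
rewrite /plucker /basis_mx; clear fs s fi; move: (vbasis (val X)) => B; move: hJ.
move: [set f c | c : 'I_k] => J hJ; rewrite /enumf; move: B; set d := \dim _ => B; move: (tval B) => l.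
case: k / hJ; congr (\det _); apply/matrixP => a c; rewrite !mxE.
by congr (l`_a 0 (enum_val _)); apply: val_inj.
Qed.

Lemma mem_basis_mx X v : v \in val X <-> exists u : 'rV_k, v = u *m basis_mx X.
Proof.
have bE (u : 'rV_k) : u *m basis_mx X = \sum_(a < k) u 0 a *: (vbasis (val X))`_a.
  apply/rowP => c; rewrite mxE summxE; apply: eq_bigr => a _.
  by rewrite !mxE.
split=> [|[u ->]]; last first.
  rewrite bE; apply: memv_suml => a _; apply: memvZ; apply: vbasis_mem.
  by rewrite mem_nth // size_tuple (eqP (valP X)).
move=> vX; have := coord_vbasis vX; set co := coord _.
(* The coordinates are indexed by the dimension, which equals k only propositionally; the default 0
   never occurs. *)
move=> vE; exists (\row_a (if insub (val a) is Some b then co b v else 0)).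
rewrite bE {1}vE; have dk : \dim (val X) = k := eqP (valP X).
rewrite (reindex (cast_ord (esym dk))) /=; last first.
  by exists (cast_ord dk) => b _; rewrite ?cast_ordK ?cast_ordKV.
apply: eq_bigr => a _; rewrite mxE; case: insubP => /= [b _ ba|]; last first.
  by have := ltn_ord (cast_ord (esym dk) a); rewrite /= => ->.
by congr (co _ v *: _); apply: val_inj.
Qed.

Lemma grassmannian_eq X X' : (forall v, v \in val X <-> v \in val X') -> X = X'.
Proof.
by move=> h; apply: val_inj; apply/vspaceP => v; apply/idP/idP => /h.
Qed.

Definition upd f a j := fun c => if c == a then j else f c.

Lemma upd_inj f a j : injective f -> (forall c, f c != j) -> injective (upd f a j).
Proof.
move=> fi nj b c; rewrite /upd.
have [->|_] := eqVneq b a; have [->|_] //= := eqVneq c a.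
- by move=> e; case/eqP: (nj c).
- by move=> e; case/eqP: (nj b).
exact: fi.
Qed.

Lemma upd_im f a j : injective f ->
  [set upd f a j c | c : 'I_k] = j |: ([set f c | c : 'I_k] :\ f a).
Proof.
move=> fi; apply/setP => x; rewrite !inE; apply/imsetP/idP => [[c _ ->]|].
  rewrite /upd; have [_|ca] := eqVneq c a; first by rewrite eqxx.
  by rewrite (inj_eq fi) ca imset_f ?orbT.
case/predU1P => [->|/andP[xa /imsetP[c _ xc]]].
  by exists a; rewrite // /upd eqxx.
exists c => //; rewrite /upd ifN // -(inj_eq fi) -xc //.
Qed.

(** Expand along row [a]: all its entries outside the replaced column vanish, and the complementary
    minor is that of an identity matrix. *)
Lemma det_upd (C : 'M[R]_(k, n)) f a j : colsub f C = 1%:M ->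
  \det (colsub (upd f a j) C) = C a j.
Proof.
move=> Cf; have Cfe b c : C b (f c) = (b == c)%:R.
  by have := congr1 (fun M : 'M_k => M b c) Cf; rewrite !mxE.
rewrite (expand_det_row _ a) (bigD1 a) //= big1 ?addr0 => [|c ca].
  rewrite !mxE /upd eqxx /cofactor -signr_odd oddD addbb mul1r.
  suff -> : row' a (col' a (colsub (upd f a j) C)) = 1%:M by rewrite det1 mulr1.
  apply/matrixP => b c; rewrite !mxE /upd eq_sym (negPf (neq_lift _ _)) Cfe.
  by rewrite (inj_eq lift_inj).
by rewrite !mxE /upd (negPf ca) Cfe eq_sym (negPf ca) mul0r.
Qed.

(** The row-reduced matrix of the plane with pivot columns [f]; its other entries are the
    coordinates of the affine chart where the Plucker coordinate of the image of [f] is nonzero. *)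
Definition reduced f X := invmx (colsub f (basis_mx X)) *m basis_mx X.

Lemma colsub_mul p (A : 'M[R]_(p, k)) (B : 'M[R]_(k, n)) m (f : 'I_m -> 'I_n) :
  colsub f (A *m B) = A *m colsub f B.
Proof. by apply/matrixP => i j; rewrite !mxE; apply: eq_bigr => l _; rewrite mxE. Qed.

Section Reduced.
Variables (X : grassmannian R k n) (f : 'I_k -> 'I_n).
Hypotheses (fi : injective f) (nz : plucker X [set f c | c : 'I_k] != 0).

Lemma reduced_unit : colsub f (basis_mx X) \in unitmx.
Proof.
by move: nz; rewrite plucker_det // mulf_eq0 negb_or unitmxE unitfE => /andP[].
Qed.

Lemma colsub_reduced : colsub f (reduced f X) = 1%:M.
Proof. by rewrite colsub_mul mulVmx // reduced_unit. Qed.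

Lemma basis_mx_reduced : basis_mx X = colsub f (basis_mx X) *m reduced f X.
Proof. by rewrite mulKVmx // reduced_unit. Qed.

Lemma mem_reduced v : v \in val X <-> exists u : 'rV_k, v = u *m reduced f X.
Proof.
rewrite mem_basis_mx; split=> -[u ->].
  by exists (u *m colsub f (basis_mx X)); rewrite -mulmxA -basis_mx_reduced.
by exists (u *m invmx (colsub f (basis_mx X))); rewrite -mulmxA.
Qed.

Lemma plucker_reduced g : injective g ->
  plucker X [set g c | c : 'I_k] =
    Num.sg (vdm g) * \det (colsub f (basis_mx X)) * \det (colsub g (reduced f X)).
Proof.
by move=> gi; rewrite plucker_det // {1}basis_mx_reduced colsub_mul det_mulmx mulrA.
Qed.

Lemma reduced_entry a j : (forall c, f c != j) ->
  reduced f X a j = Num.sg (vdm (upd f a j)) * Num.sg (vdm f) *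
    (plucker X (j |: ([set f c | c : 'I_k] :\ f a)) / plucker X [set f c | c : 'I_k]).
Proof.
move=> nj; have gi : injective (upd f a j) by exact: upd_inj.
rewrite -upd_im // plucker_reduced // det_upd ?colsub_reduced // plucker_det //.
have d0 : \det (colsub f (basis_mx X)) != 0 by rewrite -unitfE -unitmxE reduced_unit.
have s0 : Num.sg (vdm f) != 0 by rewrite sgr_eq0 vdm_neq0.
rewrite -[LHS]mul1r -(sg_vdm_sqr gi); field.
by rewrite d0 s0.
Qed.

End Reduced.
End Subspace.
End Plucker.

(** * Charts of the Grassmannian and its three-term relations *)

Section PluckerCoordinates.
Variables (R : realFieldType).

Section Determined.
Variables (k n : nat).
Implicit Types (X : grassmannian R k n) (I J K : {set 'I_n}).

(** By [reduced_entry] the given ratios are, up to signs independent of the plane, all entries of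
    the reduced matrix outside its identity block, and that matrix spans the plane. *)
Lemma plucker_determines X X' I : #|I| = k -> plucker X I != 0 -> plucker X' I != 0 ->
  (forall i j, i \in I -> j \notin I ->
    plucker X (j |: (I :\ i)) / plucker X I = plucker X' (j |: (I :\ i)) / plucker X' I) ->
  X = X'.
Proof.
move=> hI; set f := enumf hI; have fi : injective f := @enumf_inj _ _ _ hI.
rewrite -{1 2 4 6}(enumf_im hI) -/f => nz nz' ratio.
suff eqC : reduced f X = reduced f X'.
  apply: grassmannian_eq => v.
  by rewrite (mem_reduced fi nz) (mem_reduced fi nz') eqC.
apply/matrixP => a j.
have [/existsP[c /eqP <-]|/existsPn nj] := boolP [exists c, f c == j].
  have := colsub_reduced fi nz; have := colsub_reduced fi nz'.
  move=> /(congr1 (fun M : 'M_k => M a c)) e1 /(congr1 (fun M : 'M_k => M a c)) e2.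
  by move: e1 e2; rewrite !mxE => -> ->.
rewrite !reduced_entry //; congr (_ * _).
have := ratio (f a) j; rewrite (enumf_im hI); apply; first exact: enum_valP.
by apply/negP; rewrite -(enumf_im hI) => /imsetP[c _ jc]; move: (nj c); rewrite jc eqxx.
Qed.

(** Take the row space of the reduced matrix whose entries are dictated by [reduced_entry]. *)
Lemma plucker_exists I (m : 'I_n -> 'I_n -> R) : #|I| = k ->
  exists X, plucker X I != 0 /\
    forall i j, i \in I -> j \notin I -> plucker X (j |: (I :\ i)) / plucker X I = m i j.
Proof.
move=> hI; set f := enumf hI; have fi : injective f := @enumf_inj _ _ _ hI.
pose C : 'M[R]_(k, n) := \matrix_(a, j) if j \in I then (f a == j)%:R
  else Num.sg (vdm R (upd f a j)) * Num.sg (vdm R f) * m (f a) j.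
have fI c : f c \in I by exact: enum_valP.
have Cf : colsub f C = 1%:M.
  by apply/matrixP => a b; rewrite !mxE fI (inj_eq fi).
pose h : 'Hom('rV[R]_k, 'rV[R]_n) := linfun (mulmxr C).
have hE u : h u = u *m C by rewrite lfunE.
have lk : lker h == 0%VS.
  apply/lker0P => u v; rewrite !hE => /(congr1 (colsub f)).
  by rewrite !colsub_mul Cf !mulmx1.
have dimV : \dim (limg h) == k.
  by rewrite limg_dim_eq ?(eqP lk) ?capv0 // dimvf dim_matrix mul1r.
pose X : grassmannian R k n := exist _ (limg h) dimV.
have XC v : v \in val X <-> exists u : 'rV_k, v = u *m C.
  split=> [/memv_imgP[u _ ->]|[u ->]]; first by exists u.
  by rewrite -hE memv_img ?memvf.
have rowP (M M' : 'M[R]_(k, n)) : (forall a, exists u : 'rV_k, row a M = u *m M') ->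
    exists P : 'M_k, M = P *m M'.
  move=> ex; suff : (M <= M')%MS by move/submxP.
  by apply/row_subP => a; have [u ->] := ex a; exact: submxMl.
(* [vbasis] need not return the rows of [C]. The base change [P] is invertible because [C] contains
   an identity block, and its determinant cancels in the ratios. *)
have [P BP] : exists P : 'M_k, basis_mx X = P *m C.
  by apply: rowP => a; apply/XC/mem_basis_mx; exists (delta_mx 0 a); rewrite rowE.
have [Q CQ] : exists P : 'M_k, C = P *m basis_mx X.
  by apply: rowP => a; apply/mem_basis_mx/XC; exists (delta_mx 0 a); rewrite rowE.
have dP : \det P != 0.
  have := congr1 determinant Cf; rewrite CQ BP mulmxA colsub_mul Cf mulmx1 det_mulmx det1.
  by move=> e; apply/eqP => z; move/eqP: e; rewrite z mulr0 eq_sym oner_eq0.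
have pl g : injective g -> plucker X [set g c | c : 'I_k] =
    Num.sg (vdm R g) * \det P * \det (colsub g C).
  by move=> gi; rewrite plucker_det // BP colsub_mul det_mulmx mulrA.
have plI : plucker X I = Num.sg (vdm R f) * \det P.
  by rewrite -{1}(enumf_im hI) pl // Cf det1 mulr1.
have sf : Num.sg (vdm R f) != 0 by rewrite sgr_eq0 vdm_neq0.
exists X; split; first by rewrite plI mulf_neq0.
move=> i j iI jI; have [a _ ia] : exists2 a, a \in 'I_k & i = f a.
  by move: iI; rewrite -{1}(enumf_im hI) => /imsetP.
have nj c : f c != j by apply: contraNneq jI => <-.
have gi : injective (upd f a j) by exact: upd_inj.
rewrite ia -{1}(enumf_im hI) -upd_im // pl // det_upd // mxE (negPf jI) plI.
rewrite -[RHS]mul1r -(sg_vdm_sqr R gi); field.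
by rewrite dP sf.
Qed.

End Determined.

Section ThreeTerm.
Variables (k n : nat) (K : {set 'I_n}) (hK : #|K| = k).
Variable (X : grassmannian R k.+2 n).
Implicit Types (u v w z : 'I_n).

(** With the free columns first, reduction makes every minor containing [K] a 2 by 2 minor; the
    price is a sign for sorting. *)
Definition two_first u v (c : 'I_k.+2) : 'I_n :=
  match unlift ord0 c with
  | None => u
  | Some c' => if unlift ord0 c' is Some c'' then enumf hK c'' else v
  end.

Lemma two_first0 u v : two_first u v ord0 = u.
Proof. by rewrite /two_first unlift_none. Qed.
Lemma two_first1 u v : two_first u v (lift ord0 ord0) = v.
Proof. by rewrite /two_first liftK unlift_none. Qed.
Lemma two_first2 u v c : two_first u v (lift ord0 (lift ord0 c)) = enumf hK c.
Proof. by rewrite /two_first !liftK. Qed.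

Lemma two_first_im u v : [set two_first u v c | c : 'I_k.+2] = u |: (v |: K).
Proof.
apply/setP => x; rewrite !inE; apply/imsetP/idP => [[c _ ->]|].
  case: (unliftP ord0 c) => [c' ->|->]; last by rewrite two_first0 eqxx.
  case: (unliftP ord0 c') => [c'' ->|->]; last by rewrite two_first1 eqxx orbT.
  by rewrite two_first2 [_ \in K]enum_valP !orbT.
case/or3P => [/eqP ->|/eqP ->|].
- by exists ord0; rewrite // two_first0.
- by exists (lift ord0 ord0); rewrite // two_first1.
rewrite -{1}(enumf_im hK) => /imsetP[c _ ->].
by exists (lift ord0 (lift ord0 c)); rewrite // two_first2.
Qed.

Lemma two_first_inj u v : u != v -> u \notin K -> v \notin K -> injective (two_first u v).
Proof.
move=> uv uK vK; apply/injectiveP/card_uniqP.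
rewrite size_map -cardE card_ord -[LHS]cardsE.
have -> : [set x in [seq two_first u v x | x : 'I_k.+2]] = u |: (v |: K).
  by rewrite -two_first_im; apply/setP => x; rewrite inE; apply/imageP/imsetP => -[c _ ->]; exists c.
by rewrite !cardsU1 !inE (negPf uv) (negPf uK) vK hK.
Qed.

(** The parity of the number of elements of [K] below [u], that is, the sign of moving column [u]
    from the front to its place. *)
Definition sgK u := Num.sg (\prod_(c < k) ((enumf hK c)%:R - u%:R : R)).

Lemma sg_vdm_two_first u v : Num.sg (vdm R (two_first u v)) =
  Num.sg (v%:R - u%:R : R) * sgK u * sgK v * Num.sg (vdm R (enumf hK)).
Proof.
rewrite /sgK -!sgrM; congr Num.sg; rewrite /vdm !det_Vandermonde.
under eq_bigr => i _ do under eq_bigr => j _ do rewrite !mxE.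
rewrite big_ord_recl big_ord_recl.
rewrite [X in X * _ = _]big_mkcond big_ord_recl /= mul1r.
rewrite big_ord_recl /= two_first0 two_first1.
under eq_bigr => c _ do rewrite two_first2.
rewrite [X in _ * (X * _) = _]big_mkcond !big_ord_recl /= !mul1r.
under [X in _ * (X * _) = _]eq_bigr => c _ do rewrite two_first2.
rewrite -!mulrA; congr (_ * (_ * (_ * _))); apply: eq_bigr => i _.
rewrite [LHS]big_mkcond !big_ord_recl /= !mul1r [RHS]big_mkcond /=.
by apply: eq_bigr => j _; rewrite /bump /= !add1n !ltnS !two_first2 !mxE.
Qed.

(** The columns of [K] are unit vectors supported below the first two rows, so the matrix is block
    lower triangular with an identity as its lower block. *)
Lemma det_two_first (C : 'M[R]_(k.+2, n)) u v w z : colsub (two_first w z) C = 1%:M ->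
  \det (colsub (two_first u v) C) =
  C ord0 u * C (lift ord0 ord0) v - C (lift ord0 ord0) u * C ord0 v.
Proof.
move=> Cwz; have Ce b c : C b (enumf hK c) = (b == lift ord0 (lift ord0 c))%:R.
  have := congr1 (fun M : 'M_k.+2 => M b (lift ord0 (lift ord0 c))) Cwz.
  by rewrite !mxE two_first2.
pose M : 'M[R]_(2 + k) := colsub (two_first u v) C.
have -> : \det (colsub (two_first u v) C) = \det M by [].
rewrite -[M]submxK.
have -> : ursubmx M = 0.
  apply/matrixP => a c; rewrite !mxE.
  have -> : rshift 2 c = lift ord0 (lift ord0 c) by apply: val_inj.
  rewrite two_first2 Ce; case: eqP => // /(congr1 val) /= e.
  by have := ltn_ord a; rewrite e.
have -> : drsubmx M = 1%:M.
  apply/matrixP => a c; rewrite !mxE.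
  have e d : rshift 2 d = lift ord0 (lift ord0 d) :> 'I_k.+2 by apply: val_inj.
  by rewrite !e two_first2 Ce !(inj_eq lift_inj).
rewrite det_lblock det1 mulr1 (expand_det_row _ ord0) !big_ord_recl big_ord0 addr0.
rewrite /cofactor !det_mx11 !mxE /=.
have e0 : lshift k (ord0 : 'I_2) = ord0 :> 'I_k.+2 by apply: val_inj.
have e1 : lshift k (lift ord0 ord0 : 'I_2) = lift ord0 ord0 :> 'I_k.+2 by apply: val_inj.
have e2 : lshift k (lift (lift ord0 ord0 : 'I_2) 0) = ord0 :> 'I_k.+2 by apply: val_inj.
rewrite !e0 !e1 !e2 !two_first0 !two_first1 /= !addn0 !add0n expr0 expr1 mul1r mulN1r mulrN.
by rewrite [C ord0 v * _]mulrC.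
Qed.

Definition signed_plucker u v := Num.sg (v%:R - u%:R : R) * plucker X (u |: (v |: K)).

(** Each product carries the factor [sgK] of all four indices and the squares of the same two
    quantities. What remains is the quadratic relation between the 2 by 2 minors of two rows of the
    matrix reduced at [u], [v] and [K]. *)
Lemma plucker_three_term u v w z : uniq [:: u; v; w; z] ->
  u \notin K -> v \notin K -> w \notin K -> z \notin K ->
  plucker X (u |: (v |: K)) != 0 ->
  signed_plucker u v * signed_plucker w z - signed_plucker u w * signed_plucker v z + signed_plucker u z * signed_plucker v w = 0.
Proof.
move=> + uK vK wK zK nz; rewrite /= !inE !negb_or andbT.
case/and3P => /and3P[uv uw uz] /andP[vw vz] wz.
have sgplE a b : a != b -> a \notin K -> b \notin K -> signed_plucker a b =
    sgK a * sgK b * Num.sg (vdm R (enumf hK)) * \det (colsub (two_first u v) (basis_mx X)) *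
    \det (colsub (two_first a b) (reduced (two_first u v) X)).
  move=> ab aK bK; have fi := two_first_inj ab aK bK.
  have fuv := two_first_inj uv uK vK.
  rewrite /signed_plucker -two_first_im (plucker_reduced fuv) ?two_first_im // sg_vdm_two_first.
  have s1 : Num.sg (b%:R - a%:R : R) * Num.sg (b%:R - a%:R) = 1.
    by rewrite -expr2 sqr_sg subr_eq0 eqr_nat eq_sym (inj_eq val_inj) ab.
  by rewrite !mulrA s1 mul1r.
have Cuv : colsub (two_first u v) (reduced (two_first u v) X) = 1%:M.
  by apply: colsub_reduced; rewrite ?two_first_im //; exact: two_first_inj.
rewrite !sgplE // !(det_two_first _ _ Cuv).
set C := reduced _ _; set s := Num.sg (vdm R _); set D := \det _.
move: (sgK u) (sgK v) (sgK w) (sgK z) => su sv sw sz.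
ring.
Qed.

End ThreeTerm.
End PluckerCoordinates.

(** * Flows and the sum over walks *)

Section Flows.
Variables (R : realFieldType) (n : nat) (N : network R n).
Hypothesis pN : perfect N.
Local Notation tw := (twin N).
Local Notation stp := (@step R n N).
Local Notation lg := (leg N).
Implicit Types (i j : 'I_n) (d e x y : dart N) (A F : {set dart N}) (S T : {set 'I_n}).
Implicit Types (c p s : seq (dart N)).

Lemma step_vtx d e : step d e -> vtx (tw d) = vtx e.
Proof. by case/andP => _ /vtx_same. Qed.

Lemma vtx_twin_step d e f : step d e -> f \in vtx e -> out f -> step d f.
Proof. by move=> de fe fo; rewrite /step fo (step_vtx de). Qed.

Definition heads F x := [set y in vtx x | tw y \in F].

Definition isflow S T F := [/\ F \subset [set d | out d],
  forall x, internal x -> #|F :&: vtx x| = #|heads F x|,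
  forall i, (lg i \in F) = (i \in S) & forall i, (tw (lg i) \in F) = (i \in T)].

Lemma headsU A F x : heads (A :|: F) x = heads A x :|: heads F x.
Proof. by apply/setP => y; rewrite !inE andb_orr. Qed.

Lemma heads_disjoint A F x : [disjoint A & F] -> [disjoint heads A x & heads F x].
Proof.
move/pred0P => dAF; apply/pred0P => y /=; rewrite !inE.
by have := dAF (tw y) => /=; case: (tw y \in A); rewrite ?andbF //= => ->; rewrite !andbF.
Qed.

Lemma flowU S T A S' T' F : [disjoint A & F] ->
  isflow S T A -> isflow S' T' F -> isflow (S :|: S') (T :|: T') (A :|: F).
Proof.
move=> dis [oA bA sA tA] [oF bF sF tF]; split => [|x xi|i|i]; rewrite ?inE ?sA ?sF ?tA ?tF //.
  by rewrite subUset oA.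
rewrite headsU setIUl !cardsU bA // bF //.
have /eqP -> : A :&: vtx x :&: (F :&: vtx x) == set0.
  by rewrite setIACA setIid -subset0 (disjoint_setI0 dis) set0I.
by rewrite (disjoint_setI0 (heads_disjoint x dis)).
Qed.

Lemma flowD S T A S' T' F : A \subset F ->
  isflow S T F -> isflow S' T' A -> isflow (S :\: S') (T :\: T') (F :\: A).
Proof.
move=> AF [oF bF sF tF] [oA bA sA tA]; split => [|x xi|i|i]; rewrite ?inE ?sA ?sF ?tA ?tF //.
  exact: subset_trans (subsetDl _ _) oF.
have FE : F = A :|: (F :\: A).
  by apply/setP => y; rewrite !inE; have [/(subsetP AF)|] := boolP (y \in A).
have dis : [disjoint A & F :\: A].
  by rewrite -setI_eq0; apply/eqP/setP => y; rewrite !inE; case: (y \in A).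
have := bF x xi; move: FE dis; set G := F :\: A => FE dis.
rewrite FE headsU setIUl !cardsU (bA x xi).
have /eqP -> : A :&: vtx x :&: (G :&: vtx x) == set0.
  by rewrite setIACA setIid -subset0 (disjoint_setI0 dis) set0I.
rewrite (disjoint_setI0 (heads_disjoint x dis)) !cards0 !subn0.
by move/addnI.
Qed.

Section OneFlow.
Variables (S T : {set 'I_n}) (F : {set dart N}).
Hypothesis hF : isflow S T F.

Lemma flow_out d : d \in F -> out d.
Proof. by have [/subsetP oF _ _ _] := hF => /oF; rewrite inE. Qed.

(** A vertex with several outgoing edges has a single incoming one, and balance carries that bound
    over. Hence the components of a flow are vertex-disjoint. *)
Lemma flow_card x : internal x -> (#|F :&: vtx x| <= 1)%N.
Proof.
move=> xi; have [oF bF _ _] := hF; have [<-|<-] := pN xi; last rewrite bF //.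
  apply: subset_leq_card; apply/subsetP => y; rewrite !inE => /andP[yF ->].
  by rewrite flow_out.
apply: subset_leq_card; apply/subsetP => y; rewrite !inE => /andP[-> yF].
by have := flow_out yF; rewrite out_twin.
Qed.

Lemma flow_tail_inj x y : x \in F -> y \in F -> x \in vtx y -> x = y.
Proof.
move=> xF yF xy; have [yi|/internalPn[i yi]] := boolP (internal y); last first.
  by move: xy; rewrite yi vtx_leg inE => /eqP.
have := flow_card yi; move/card_le1_eqP; apply; rewrite inE ?xF ?yF //=.
exact: vtx_id.
Qed.

Lemma flow_head_inj x y : x \in F -> y \in F -> tw x \in vtx (tw y) -> x = y.
Proof.
move=> xF yF xy; apply: (@perm_inj _ tw).
have [yi|/internalPn[i yi]] := boolP (internal (tw y)); last first.
  by move: xy; rewrite yi vtx_leg inE => /eqP.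
have [_ bF _ _] := hF; have := flow_card yi; rewrite bF //.
by move/card_le1_eqP; apply; rewrite inE twinK ?xF ?yF ?andbT // vtx_id.
Qed.

Lemma flow_succ x : x \in F -> internal (tw x) -> exists2 y, y \in F & y \in vtx (tw x).
Proof.
move=> xF xi; have [_ bF _ _] := hF.
have : (0 < #|heads F (tw x)|)%N.
  by rewrite card_gt0; apply/set0Pn; exists (tw x); rewrite inE twinK xF vtx_id.
rewrite -bF // card_gt0 => /set0Pn[y]; rewrite inE => /andP[yF yv].
by exists y.
Qed.

(** A flow edge ending at the boundary is sent to [d0]. Taking [d0] to be the initial leg closes a
    path into a cycle, so that paths and cycles are both orbits. *)
Definition succ_dart d0 d : dart N :=
  if d \in F then odflt d0 [pick e in F | e \in vtx (tw d)] else d.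

Lemma succ_dartE d0 x y : x \in F -> y \in F -> y \in vtx (tw x) -> succ_dart d0 x = y.
Proof.
move=> xF yF yx; rewrite /succ_dart xF; case: pickP => [z /andP[zF zx]|/(_ y)] /=.
  by apply: flow_tail_inj => //; rewrite (vtx_same yx).
by rewrite yF yx.
Qed.

Lemma succ_dart_step x y d0 : x \in F -> y \in F -> step x y -> succ_dart d0 x = y.
Proof. by move=> xF yF /andP[_]; exact: succ_dartE. Qed.

Lemma succ_dart_internal d0 x : x \in F -> internal (tw x) -> succ_dart d0 x \in F /\ step x (succ_dart d0 x).
Proof.
move=> xF xi; have [y yF yx] := flow_succ xF xi.
by rewrite (succ_dartE _ xF yF yx) /step yx (flow_out yF).
Qed.

Lemma succ_dart_leg d0 x : x \in F -> ~~ internal (tw x) -> succ_dart d0 x = d0.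
Proof.
move=> xF /internalPn[i xi]; rewrite /succ_dart xF; case: pickP => //= z /andP[zF].
rewrite xi vtx_leg inE => /eqP zi; have := flow_out zF.
by rewrite zi -xi out_twin (flow_out xF).
Qed.

(** The two situations in which [succ_dart d0] permutes the darts: a single exit that is closed up
    through the leg [d0], or no exit at all. *)
Definition wraps d0 := (exists i, d0 = lg i) /\ d0 \in F /\
   (forall x y, x \in F -> y \in F -> ~~ internal (tw x) -> ~~ internal (tw y) -> x = y)
  \/ (forall x, x \in F -> internal (tw x)).

Lemma succ_dart_mem d0 x : wraps d0 -> x \in F -> succ_dart d0 x \in F.
Proof.
move=> w xF; have [xi|xl] := boolP (internal (tw x)).
  by have [] := succ_dart_internal d0 xF xi.
by rewrite succ_dart_leg //; case: w => [[_ []]//|/(_ x xF)]; rewrite (negPf xl).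
Qed.

Lemma succ_dart_inj d0 : wraps d0 -> injective (succ_dart d0).
Proof.
move=> w; have inF x y : x \in F -> y \in F -> succ_dart d0 x = succ_dart d0 y -> x = y.
  have half a b : a \in F -> b \in F -> internal (tw a) -> succ_dart d0 a = succ_dart d0 b -> a = b.
    move=> aF bF ai e; have [_ /step_vtx sa] := succ_dart_internal d0 aF ai.
    have [bi|bl] := boolP (internal (tw b)).
      have [_ /step_vtx sb] := succ_dart_internal d0 bF bi.
      by apply: flow_head_inj; rewrite // vtx_eq sa sb e.
    case: w => [[[i di] [dF _]]|/(_ b bF)]; last by rewrite (negPf bl).
    have := internal_vtx (vtx_id (tw a)); rewrite -{2}[tw a]twinK.
    have : tw a \in vtx (succ_dart d0 a) by rewrite vtx_eq sa.
    by rewrite e (succ_dart_leg _ bF bl) di => /internal_vtx; rewrite internal_leg ai.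
  move=> xF yF e; have [xi|xl] := boolP (internal (tw x)); first exact: half.
  have [yi|yl] := boolP (internal (tw y)); first by apply/esym/half.
  by case: w => [[_ [_ h]]|/(_ x xF)]; [exact: h | rewrite (negPf xl)].
move=> x y; have [xF|xF] := boolP (x \in F); have [yF|yF] := boolP (y \in F).
- exact: inF.
- move=> e; have := succ_dart_mem w xF; rewrite e.
  by rewrite {1}/succ_dart !(negPf yF).
- move=> e; have := succ_dart_mem w yF; rewrite -e.
  by rewrite {1}/succ_dart !(negPf xF).
by rewrite /succ_dart (negPf xF) (negPf yF).
Qed.

Lemma orbit_succ_dart d0 x : wraps d0 -> x \in F ->
  [/\ uniq (fingraph.orbit (succ_dart d0) x), {subset fingraph.orbit (succ_dart d0) x <= F},
      fcycle (succ_dart d0) (fingraph.orbit (succ_dart d0) x)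
    & exists q, fingraph.orbit (succ_dart d0) x = x :: q].
Proof.
move=> w xF; split.
- exact: orbit_uniq.
- move=> y; rewrite -fconnect_orbit => /iter_findex <-.
  by elim: (findex _ _ _) => //= k; exact: succ_dart_mem.
- exact: cycle_orbit (succ_dart_inj w) x.
by rewrite /fingraph.orbit -orderSpred /=; eexists.
Qed.

Lemma succ_dart_orbit d0 x q : uniq (x :: q) -> {subset x :: q <= F} ->
  fcycle (succ_dart d0) (x :: q) -> fingraph.orbit (succ_dart d0) x = x :: q.
Proof.
move=> uq sF fq; have o := order_cycle fq uq (mem_head x q).
rewrite /fingraph.orbit o; move: fq => /= /fpathP[m].
rewrite -cats1 => e; have sz : m = (size q).+1.
  by have := congr1 size e; rewrite size_cat size_traject addn1.
move: e; rewrite sz trajectSr cats1 => /rcons_inj[-> _] /=.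
by rewrite size_traject.
Qed.

Lemma cycle_step_succ_dart d0 c : {subset c <= F} -> path.cycle stp c -> fcycle (succ_dart d0) c.
Proof.
move=> cF; apply: (@sub_in_cycle _ (mem F)); last by apply/allP.
by move=> x y xF yF xy; apply/eqP; exact: succ_dart_step.
Qed.

End OneFlow.

Lemma cycle_out c x : path.cycle stp c -> x \in c -> out x.
Proof. by move=> cc xc; have := prev_cycle cc xc => /andP[]. Qed.

Lemma cycle_internal c x : path.cycle stp c -> x \in c -> internal x.
Proof.
move=> cc xc; have pc : prev c x \in c by rewrite mem_prev.
have := prev_cycle cc xc => /andP[xo]; apply: contraTT => /internalPn[i xi].
rewrite vtx_sym xi vtx_leg inE -xi; apply/eqP => e.
by move: xo; rewrite -e out_twin (cycle_out cc pc).
Qed.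

Lemma cycle_twin_internal c x : path.cycle stp c -> x \in c -> internal (tw x).
Proof.
move=> cc xc; have nc : next c x \in c by rewrite mem_next.
have := next_cycle cc xc => /andP[_ /internal_vtx <-].
exact: cycle_internal nc.
Qed.

(** The head of each edge is at the tail of the next one, so heads and tails at a vertex differ only
    by the ends of the path; the correction terms are added on both sides to avoid subtraction. *)
Lemma path_count x d p : path stp d p ->
  (count (fun y => tw y \in vtx x) (d :: p) + (d \in vtx x) =
   count (mem (vtx x)) (d :: p) + (tw (last d p) \in vtx x))%N.
Proof.
elim: p d => [|e p IH] d; first by move=> _ /=; rewrite !addn0 addnC.
case/andP => de /IH ih; move: ih; set P := e :: p => ih.
rewrite [count _ (d :: P)]/= [count (mem _) (d :: P)]/= [last d P]/=.
have -> : (tw d \in vtx x) = (e \in vtx x) by rewrite !vtx_eq (step_vtx de).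
by rewrite -/P -addnA [(_ + (d \in _))%N]addnC addnCA [((e \in _) + _)%N]addnC ih addnA.
Qed.

Lemma card_seq_vtx p x : uniq p ->
  #|[set y in p] :&: vtx x| = count (mem (vtx x)) p.
Proof.
move=> up; rewrite -size_filter -(card_uniqP (filter_uniq _ up)).
by apply: eq_card => y; rewrite !inE mem_filter andbC.
Qed.

Lemma card_seq_heads p x : uniq p ->
  #|heads [set y in p] x| = count (fun y => tw y \in vtx x) p.
Proof.
move=> up; rewrite -size_filter -(size_map tw).
have um : uniq [seq tw y | y <- p & tw y \in vtx x].
  by rewrite map_inj_uniq ?filter_uniq //; exact: perm_inj.
rewrite -(card_uniqP um); apply: eq_card => y; rewrite !inE.
by rewrite -{3}[y]twinK (mem_map (@perm_inj _ tw)) mem_filter twinK.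
Qed.

Lemma cycle_flow c : uniq c -> path.cycle stp c -> isflow set0 set0 [set y in c].
Proof.
move=> uc cc; split => [|x xi|i|i]; rewrite ?inE.
- by apply/subsetP => x; rewrite !inE => /(cycle_out cc).
- rewrite card_seq_vtx // card_seq_heads //; move: cc; case: c uc => // d p _.
  rewrite [path.cycle _ _]rcons_path => /andP[dp /step_vtx ld].
  have := path_count x dp; rewrite [tw _ \in _]vtx_eq ld -vtx_eq.
  by move/addIn => <-.
- by apply/negP => /(cycle_internal cc); rewrite internal_leg.
by apply/negP => /(cycle_twin_internal cc); rewrite twinK internal_leg.
Qed.

Lemma dpathP i j p : reflect
  (exists q, [/\ p = lg i :: q, out (lg i), path stp (lg i) q & tw (last (lg i) q) = lg j])
  (dpath i j p).
Proof.
case: p => [|d q]; first by constructor; case=> ? [].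
apply: (iffP and4P) => [[/eqP -> ? ? /eqP ?]|[q' [[-> ->] ? ? ->]]]; first by exists q.
by rewrite !eqxx.
Qed.

Lemma path_out d p x : out d -> path stp d p -> x \in d :: p -> out x.
Proof.
elim: p d => [|e p IH] d dO /=; first by rewrite inE => _ /eqP ->.
case/andP => /andP[eo _] ep; rewrite inE => /predU1P[->//|].
exact: IH eo ep.
Qed.

Lemma path_internal d p x : out d -> path stp d p -> x \in p -> internal x.
Proof.
elim: p d => [|e p IH] d dO //= /andP[de ep].
have eo : out e by case/andP: de.
rewrite inE => /predU1P[->|]; last exact: IH eo ep.
apply: contraLR dO => /internalPn[i ei]; case/andP: de => _.
rewrite vtx_sym ei vtx_leg inE -ei => /eqP e'.
by move: eo; rewrite -e' out_twin.
Qed.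

Lemma path_twin_internal d p x : out d -> path stp d p -> x \in belast d p -> internal (tw x).
Proof.
elim: p d => [|e p IH] d dO //= /andP[de ep].
have eo : out e by case/andP: de.
rewrite inE => /predU1P[->|]; last exact: IH eo ep.
have ei : internal e.
  by apply: (@path_internal d [:: e]); rewrite /= ?andbT // mem_head.
by case/andP: de => _ /internal_vtx <-.
Qed.

Lemma dpath_flow i j p : uniq p -> dpath i j p -> isflow [set i] [set j] [set y in p].
Proof.
move=> up /dpathP[q [pE io iq lj]]; rewrite {}pE in up *.
split => [|x xi|l|l]; rewrite ?inE.
- by apply/subsetP => x; rewrite inE => /(path_out io iq); rewrite inE.
- rewrite card_seq_vtx // card_seq_heads //; have := path_count x iq.
  have legF l : (lg l \in vtx x) = false.
    by apply/negP => /internal_vtx; rewrite internal_leg xi.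
  by rewrite lj !legF !addn0.
- rewrite (inj_eq (@dm_leg_inj _ N)); case: eqP => //= _; apply/negP => lq.
  by have := path_internal io iq lq; rewrite internal_leg.
apply/idP/eqP => [lq|->]; last by rewrite -lj twinK -in_cons mem_last.
apply: (@dm_leg_inj _ N); rewrite -lj -[LHS]twinK; congr (tw _).
move: lq; rewrite -in_cons lastI mem_rcons inE => /predU1P[//|lb].
by have := path_twin_internal io iq lb; rewrite twinK internal_leg.
Qed.

End Flows.

(** * The sign-reversing involution on walks with disjoint cycles *)

Section Flip.
Variables (R : realFieldType) (n : nat) (N : network R n).
Hypothesis pN : perfect N.
Local Notation tw := (twin N).
Local Notation stp := (@step R n N).
Local Notation lg := (leg N).
Implicit Types (i j : 'I_n) (d e x y z : dart N) (A F : {set dart N}) (S T : {set 'I_n}).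
Implicit Types (c p q s u r : seq (dart N)).

Definition conservative A := isflow set0 set0 A.

Lemma conservative_internal A x : conservative A -> x \in A -> internal x.
Proof.
case=> _ _ sA _; apply: contraTT => /internalPn[i ->].
by rewrite sA inE.
Qed.

Lemma conservative_twin_internal A x : conservative A -> x \in A -> internal (tw x).
Proof.
case=> _ _ _ tA; apply: contraTT => /internalPn[i xi].
by rewrite -[x]twinK xi tA inE.
Qed.

Lemma conservative_wraps A d : conservative A -> wraps A d.
Proof. by move=> cA; right=> x; exact: conservative_twin_internal. Qed.

(** No event happens while [wind_from] and [flip] read [u] after the simple path [s]: no cycle of
    [A] is met and no loop is closed. *)
Fixpoint quiet A s u : bool :=
  if u is d :: u' then
    [&& [pick e in A | e \in vtx (tw d)] == None,
        ~~ has (fun a => a \in vtx (tw d)) (rcons s d) & quiet A (rcons s d) u']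
  else true.

(* Follows [wind_from] up to the first time that the path closes a cycle or
   meets a cycle of [A]: in the former case the cycle is moved to [A], in the
   latter it is spliced into the path. *)
Fixpoint flip A s p : {set dart N} * seq (dart N) :=
  if p is d :: p' then
    let s' := rcons s d in
    if [pick e in A | e \in vtx (tw d)] is Some e then
      let c := fingraph.orbit (succ_dart A e) e in (A :\: [set x in c], s' ++ c ++ p')
    else
      let k := find (fun a => a \in vtx (tw d)) s' in
      if (k < size s')%N then (A :|: [set x in drop k s'], take k s' ++ p')
      else flip A s' p'
  else (A, s).

Lemma wind_quiet A s u r : quiet A s u -> wind_from s (u ++ r) = wind_from (s ++ u) r.
Proof.
elim: u s => [|d u IH] s /=; first by rewrite cats0.
case/and3P => _; rewrite has_find -leqNgt ltnNge => -> /= /IH ->.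
by rewrite cat_rcons.
Qed.

Lemma flip_quiet A s u r : quiet A s u -> flip A s (u ++ r) = flip A (s ++ u) r.
Proof.
elim: u s => [|d u IH] s /=; first by rewrite cats0.
case/and3P => /eqP ->; rewrite has_find -leqNgt ltnNge => -> /= /IH ->.
by rewrite cat_rcons.
Qed.

Lemma quiet0 A s u : quiet A s u -> quiet set0 s u.
Proof.
elim: u s => //= d u IH s /and3P[_ -> /IH ->] /=; rewrite andbT.
by case: pickP => // x; rewrite inE.
Qed.

Lemma quiet_cat A s u r : quiet A s (u ++ r) = quiet A s u && quiet A (s ++ u) r.
Proof.
elim: u s => [|d u IH] s /=; first by rewrite cats0.
by rewrite IH cat_rcons -!andbA.
Qed.

Definition sep s := pairwise (fun a b => a \notin vtx b) s.
Definition avoid A s := all (fun d => [forall a in A, a \notin vtx d]) s.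

Lemma avoidP A s : reflect (forall d a, d \in s -> a \in A -> a \notin vtx d) (avoid A s).
Proof.
apply: (iffP allP) => [h d a ds aA|h d ds].
  by have /forall_inP := h d ds; apply.
by apply/forall_inP => a; apply: h.
Qed.

Lemma avoid_cat A s u : avoid A (s ++ u) = avoid A s && avoid A u.
Proof. exact: all_cat. Qed.

Lemma sep_cat s u : sep (s ++ u) =
  [&& allrel (fun a b => a \notin vtx b) s u, sep s & sep u].
Proof. exact: pairwise_cat. Qed.

Lemma sep_uniq s : sep s -> uniq s.
Proof.
rewrite /sep; elim: s => //= d s IH /andP[/allP h /IH ->]; rewrite andbT.
by apply/negP => /h; rewrite vtx_id.
Qed.

(** The head of each dart of [u] is the tail of the next one, so conditions on tails suffice; the
    extra dart [z] covers the head of the last one. *)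
Lemma quiet_intro A s u z : sorted stp (rcons u z) -> sep (s ++ rcons u z) ->
  avoid A (rcons u z) -> quiet A s u.
Proof.
elim: u s => //= d u IH s pa se; rewrite /avoid /= => /andP[_ av].
have [f [r [rE df]]] : exists f r, rcons u z = f :: r /\ step d f.
  by case: (u) pa => [|f r] /= /andP[df _]; [exists z, [::] | exists f, (rcons r z)].
have sor : sorted stp (rcons u z) := path_sorted pa.
have fu : f \in rcons u z by rewrite rE mem_head.
apply/and3P; split.
- case: pickP => // a /andP[aA]; rewrite (step_vtx df) => av'.
  by have /avoidP/(_ f a fu aA) := av; rewrite av'.
- apply/hasPn => a ar; rewrite (step_vtx df).
  move: se; rewrite -cat_rcons sep_cat => /and3P[/allrelP h _ _].
  by apply: h.
by apply: IH; rewrite // cat_rcons.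
Qed.

Lemma quiet_last A s p d : {in A, forall a, out a} -> {in s ++ d :: p, forall a, out a} ->
  path stp d p -> ~~ internal (tw (last d p)) -> sep (s ++ d :: p) -> avoid A (d :: p) ->
  quiet A s (d :: p).
Proof.
move=> oA os; rewrite lastI => pa lt se av.
have so : sorted stp (rcons (belast d p) (last d p)) by rewrite -lastI.
rewrite -cats1 quiet_cat (quiet_intro so se av) /= andbT.
have [i li] := internalPn _ lt.
have ol : out (last d p).
  by apply: os; rewrite mem_cat mem_last orbT.
have no a : out a -> a \in vtx (tw (last d p)) = false.
  move=> oa; rewrite li vtx_leg inE -li; apply/eqP => e.
  by move: oa; rewrite e out_twin ol.
apply/andP; split.
  by case: pickP => // a /andP[/oA/no ->].
by apply/hasPn => a; rewrite -cats1 -catA cats1 -lastI => /os /no ->.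
Qed.

(** Converse of [quiet_intro]: an uneventful run leaves a simple path that is disjoint from [A]. *)
Lemma quiet_sep A s p d : path stp d p -> sep (rcons s d) -> avoid A (rcons s d) ->
  quiet A s (d :: p) -> sep (s ++ d :: p) /\ avoid A (s ++ d :: p).
Proof.
elim: p s d => [|f p IH] s d; first by rewrite cats1.
move=> /andP[df fp] se av.
rewrite [quiet _ _ _]/= => /and3P[/eqP h1 /hasPn h2 h3].
have nA a : a \in A -> a \notin vtx f.
  move=> aA; move: h1; case: pickP => // /(_ a); rewrite aA (step_vtx df) /=.
  by move=> ->.
rewrite -cat_rcons; apply: IH => //.
  rewrite -cats1 sep_cat se /= andbT; apply/allrelP => a b ar.
  by rewrite inE => /eqP ->; rewrite -(step_vtx df); exact: h2.
rewrite -cats1 avoid_cat av /=; apply/andP; split => //.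
by apply/forall_inP.
Qed.

Definition set_monom A : 'X_{1..#|dart N|} := [multinom (enum_val v \in A : nat) | v < #|dart N|].

Lemma pmonom_cat p q : pmonom (p ++ q) = (pmonom p + pmonom q)%MM.
Proof. by apply/mnmP => v; rewrite mnmDE !mnmE count_cat. Qed.

Lemma set_monom_seq p : uniq p -> set_monom [set x in p] = pmonom p.
Proof. by move=> up; apply/mnmP => v; rewrite !mnmE inE count_uniq_mem. Qed.

Lemma set_monomU A F : [disjoint A & F] -> set_monom (A :|: F) = (set_monom A + set_monom F)%MM.
Proof.
move=> /pred0P dis; apply/mnmP => v; rewrite mnmDE !mnmE inE.
have := dis (enum_val v) => /=.
by case: (_ \in A) (_ \in F) => [] [].
Qed.

Lemma sign_loop c (w : int) : (-1 : int) ^ (@cycle_wind n N c + w) = - ((-1) ^ w).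
Proof.
rewrite /cycle_wind exprzDr ?unitrN ?unitr1 //.
by case: ifP => _; rewrite ?expr1z ?exprN1 ?invrN1 mulN1r.
Qed.


Lemma avoid0 s : avoid set0 s.
Proof. by apply/avoidP => d a _; rewrite inE. Qed.

Lemma conservative_sep A p : conservative A -> uniq p -> {subset p <= A} -> sep p.
Proof.
move=> cA; rewrite /sep; elim: p => //= d p IH /andP[dp up] sA.
have sA' : {subset p <= A} by move=> x xp; apply: sA; rewrite inE xp orbT.
rewrite IH // andbT; apply/allP => x xp; apply/negP => dx.
have dA : d \in A by apply: sA; rewrite mem_head.
by move: dp; rewrite (flow_tail_inj pN cA dA (sA' _ xp) dx) xp.
Qed.

Section Run.
Variables (i j : 'I_n).

Lemma sorted_cat_path s d c : sorted stp (rcons s d) -> path stp d c ->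
  sorted stp (rcons s d ++ c).
Proof. by case: s => //= h t pt pc; rewrite cat_path pt last_rcons. Qed.

Lemma dpath_subst s d u v f r : dpath i j (rcons s d ++ u ++ f :: r) ->
  path stp d (v ++ f :: r) -> dpath i j (rcons s d ++ v ++ f :: r).
Proof.
case/dpathP => q [pE io pp lj] pv; apply/dpathP.
case: s pE => [|h t] /= [hE qE].
  exists (v ++ f :: r); rewrite -hE; split => //; first by rewrite hE.
  by rewrite -lj -qE !last_cat.
exists (rcons t d ++ v ++ f :: r); rewrite hE; split => //.
  by move: pp; rewrite -qE !cat_path last_rcons => /andP[-> _]; rewrite -cat_path.
by rewrite -lj -qE !last_cat.
Qed.

Lemma dpath_next s d x r : dpath i j (rcons s d ++ r) -> internal x -> x \in vtx (tw d) ->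
  exists f r', r = f :: r' /\ step d f.
Proof.
case/dpathP => q [pE io pp lj] xi xd.
have so : sorted stp (rcons s d ++ r) by rewrite pE.
case: r pE so => [|f r] pE so; last first.
  exists f, r; split => //; move: so; rewrite cat_rcons => /cat_sorted2[_ /=].
  by case/andP.
have := last_rcons (lg i) s d; rewrite -[rcons s d]cats0 pE /= => ld.
by move: xi; rewrite (internal_vtx xd) -ld lj internal_leg.
Qed.

(** The spliced cycle is simple and disjoint from the prefix and from the rest of [A]. The first
    event on the new path is thus its return to the tail of [e], which extracts exactly this cycle
    again and accounts for one more sign. *)
Lemma flip_splice A s d r e : conservative A -> dpath i j (rcons s d ++ r) ->
  sep (rcons s d) -> avoid A (rcons s d) -> e \in A -> e \in vtx (tw d) ->
  let c := fingraph.orbit (succ_dart A e) e in let q := rcons s d ++ c ++ r in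
  [/\ conservative (A :\: [set x in c]), dpath i j q,
      (set_monom (A :\: [set x in c]) + pmonom q)%MM = (set_monom A + pmonom (rcons s d ++ r))%MM,
      flip (A :\: [set x in c]) [::] q = (A, rcons s d ++ r) &
      (-1 : int) ^ wind q = - ((-1) ^ wind_from (rcons s d) r)].
Proof.
move=> cA dp se av eA ed c q.
have [uc cinA fc [c' cE]] := orbit_succ_dart pN cA (conservative_wraps e cA) eA; rewrite -/c in uc cinA fc cE.
have [f [r' [rE df]]] := dpath_next dp (conservative_internal cA eA) ed.
have cc : path.cycle stp c.
  apply: (@sub_in_cycle _ (mem A) (frel (succ_dart A e))) fc; last exact/allP.
  move=> x y xA _ /eqP <-.
  by have [] := succ_dart_internal pN cA e xA (conservative_twin_internal cA xA).
have cf := cycle_flow uc cc.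
have csub : [set x in c] \subset A by apply/subsetP => x; rewrite inE => /cinA.
have cAc : conservative (A :\: [set x in c]).
  by have := flowD csub cA cf; rewrite !setD0.
have AE : (A :\: [set x in c]) :|: [set x in c] = A.
  apply/setP => x; rewrite !inE; case: (boolP (x \in c)) => [/cinA ->|_]; last by rewrite orbF.
  by rewrite orbT.
have dis : [disjoint A :\: [set x in c] & [set x in c]].
  by rewrite -setI_eq0; apply/eqP/setP => x; rewrite !inE; case: (x \in c); rewrite ?andbF.
have [pc lc] : path stp e c' /\ step (last e c') e.
  by move: cc; rewrite cE /= rcons_path => /andP.
have so : sorted stp (rcons s d ++ c).
  apply: sorted_cat_path; last by rewrite cE /= pc /step (flow_out cA eA) ed.
  case/dpathP: dp => p [pE _ pp _].
  by have : sorted stp (rcons s d ++ r) by [rewrite pE]; case/cat_sorted2.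
have dq : dpath i j q.
  rewrite /q rE; apply: (@dpath_subst _ _ [::]); first by rewrite -rE.
  rewrite cE /= {1}/step (flow_out cA eA) ed cat_path pc /=.
  have fe : f \in vtx e by rewrite vtx_eq -(step_vtx df) (vtx_same ed).
  rewrite (vtx_twin_step lc fe); last by case/andP: df.
  case/dpathP: dp => p [pE _ pp _]; have : sorted stp (rcons s d ++ r) by rewrite pE.
  by rewrite rE => /cat_sorted2[].
have ses : sep (rcons s d ++ c).
  rewrite sep_cat se (conservative_sep cA uc cinA) !andbT; apply/allrelP => a b aS /cinA bA.
  by rewrite vtx_sym; move/avoidP: av; apply.
have noS a : a \in rcons s d -> a \notin vtx e.
  by move=> aS; rewrite vtx_sym; move/avoidP: av; apply.
have cE' : c = rcons (belast e c') (last e c') by rewrite -lastI.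
have qE : q = (rcons s d ++ belast e c') ++ last e c' :: r.
  by rewrite /q -catA -cat_rcons -cE'.
have qui : quiet (A :\: [set x in c]) [::] (rcons s d ++ belast e c').
  apply: (@quiet_intro _ _ _ (last e c')); rewrite /= rcons_cat -cE' //.
  rewrite avoid_cat; apply/andP; split; apply/avoidP => x a xs.
    by rewrite !inE => /andP[_ aA]; move/avoidP: av; apply.
  rewrite !inE => /andP[ac aA]; apply: contraNN ac => ax.
  by rewrite (flow_tail_inj pN cA aA (cinA _ xs) ax).
have fl : find (fun a => a \in vtx (tw (last e c'))) (rcons s d ++ c) = size (rcons s d).
  rewrite (step_vtx lc) find_cat ifN; last by apply/hasPn.
  by rewrite cE /= vtx_id addn0.
have sz : (size (rcons s d) < size (rcons s d ++ c))%N.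
  by rewrite size_cat cE /= addnS ltnS leq_addr.
split => //.
- by rewrite -{2}AE (set_monomU dis) (set_monom_seq uc) /q !pmonom_cat; apply/mnmP => v; rewrite !mnmDE -!addnA; congr addn; rewrite addnCA.
- rewrite qE (flip_quiet _ qui) /= rcons_cat -cE'.
  case: pickP => [x /andP[]|_].
    rewrite !inE (step_vtx lc) => /andP[xc xA] xe; move: xc.
    by rewrite (flow_tail_inj pN cA xA eA xe) cE mem_head.
  by rewrite fl sz take_size_cat // drop_size_cat // AE.
by rewrite qE /wind (wind_quiet _ qui) /= rcons_cat -cE' fl sz sign_loop take_size_cat.
Qed.

(** The mirror image of [flip_splice]: once the loop is moved to [A], the shortened path runs
    quietly up to the vertex where the loop was attached, meets it there, and splices it back
    starting from the same dart. *)
Lemma flip_loop A s d r k : conservative A -> dpath i j (rcons s d ++ r) ->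
  sep (rcons s d) -> avoid A (rcons s d) ->
  k = find (fun a => a \in vtx (tw d)) (rcons s d) -> (k < size (rcons s d))%N ->
  let c := drop k (rcons s d) in let q := take k (rcons s d) ++ r in
  [/\ conservative (A :|: [set x in c]), dpath i j q,
      (set_monom (A :|: [set x in c]) + pmonom q)%MM = (set_monom A + pmonom (rcons s d ++ r))%MM,
      flip (A :|: [set x in c]) [::] q = (A, rcons s d ++ r) &
      (-1 : int) ^ wind q = (-1) ^ wind_from (take k (rcons s d)) r].
Proof.
move=> cA dp se av kE ks c q; set s' := rcons s d in dp se av kE ks c q *.
have s'E : s' = take k s' ++ c by rewrite cat_take_drop.
have [a0 [c' cE]] : exists a0 c', c = a0 :: c'.
  have := size_drop k s'; rewrite -/c; case: (c) => [/esym/eqP|a0 c' _]; last by exists a0, c'.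
  by rewrite subn_eq0 leqNgt ks.
have a0E : a0 = nth d s' k.
  by have := nth_drop k d s' 0; rewrite -/c cE addn0.
have a0d : a0 \in vtx (tw d) by rewrite a0E kE; apply: (@nth_find _ d (fun a => a \in vtx (tw d)) s'); rewrite has_find -kE.
have lc : last a0 c' = d.
  by have := last_rcons a0 s d; rewrite -/s' s'E last_cat cE.
case/dpathP: (dp) => p [pE io pp lj].
have outs x : x \in s' -> out x.
  move=> xs; apply: path_out io pp _; rewrite -pE mem_cat xs //.
have dout : out d by apply: outs; rewrite mem_rcons mem_head.
(* The prefix is nonempty: a loop starting with the first leg would need a dart ending at the source
   [i], whose only dart is outgoing. *)
have [y [s1 s1E]] : exists y s1, take k s' = rcons s1 y.
  case/lastP: (take k s') s'E => [|s1 y]; last by exists y, s1.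
  move=> /= s'c; have a0i : a0 = lg i by move: pE; rewrite s'c cE => -[].
  move: a0d; rewrite a0i vtx_sym vtx_leg inE => /eqP e.
  by move: dout; rewrite -[d]twinK e out_twin io.
have a0int : internal a0.
  apply: (path_internal io pp); move: pE; rewrite s'E s1E cE.
  case: (s1) => [|h t] [_ <-]; rewrite /= ?mem_head //.
  by rewrite !mem_cat mem_head !orbT.
have [f [r' [rE df]]] := dpath_next dp a0int a0d.
have a0s : a0 \in s' by rewrite s'E cE mem_cat mem_head orbT.
have so : sorted stp (s' ++ r) by rewrite pE.
have so' : sorted stp ((rcons s1 y ++ c) ++ r) by rewrite -s1E -s'E.
have sc : sorted stp c.
  by move: so'; rewrite -catA => /cat_sorted2[_ /cat_sorted2[]].
have cc : path.cycle stp c.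
  by move: sc; rewrite cE /= rcons_path => ->; rewrite lc /step outs.
have ya0 : step y a0.
  move: so'; rewrite cE -catA -cats1 -catA /= => /cat_sorted2[_] /=.
  by case/andP.
have us := sep_uniq se; have uc : uniq c by rewrite drop_uniq.
have sepc : sep (rcons s1 y ++ c) by rewrite -s1E -s'E.
have csub : {subset c <= s'} := fun x xc => mem_drop xc.
have dis : [disjoint A & [set x in c]].
  rewrite -setI_eq0; apply/eqP/setP => x; rewrite !inE; apply/negP => /andP[xA /csub xs].
  by move/avoidP: av => /(_ x x xs xA); rewrite vtx_id.
have cF : conservative (A :|: [set x in c]).
  by have := flowU dis cA (cycle_flow uc cc); rewrite !setU0.
have FD : (A :|: [set x in c]) :\: [set x in c] = A.
  apply/setP => x; rewrite !inE; have := pred0P dis x; rewrite /= inE.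
  by case: (x \in c) (x \in A) => [] [].
have tk : {subset rcons s1 y <= s'} by move=> x; rewrite -s1E => /mem_take.
split => //.
- have yf : step y f.
    apply: vtx_twin_step ya0 _ _; last by case/andP: df.
    by rewrite vtx_eq -(step_vtx df) (vtx_same a0d).
  rewrite /q s1E rE; apply: (@dpath_subst _ _ c [::]).
    by rewrite catA -s1E -s'E -rE.
  by move: so; rewrite rE => /cat_sorted2[_] /=; rewrite yf.
- rewrite (set_monomU dis) (set_monom_seq uc) /q {2}s'E !pmonom_cat; apply/mnmP => v.
  by rewrite !mnmDE -!addnA; congr addn; rewrite addnCA.
- have qui : quiet (A :|: [set x in c]) [::] s1.
    apply: (@quiet_intro _ _ _ y) => /=.
    + by move: so'; rewrite -catA => /cat_sorted2[].
    + by move: sepc; rewrite sep_cat => /and3P[].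
    apply/avoidP => x a xs; rewrite !inE => /orP[aA|ac].
      by move/avoidP: av; apply => //; apply: tk.
    move: sepc; rewrite sep_cat => /and3P[/allrelP h _ _].
    by rewrite vtx_sym; apply: h.
  rewrite /q s1E cat_rcons (flip_quiet _ qui) /=.
  have a0F : a0 \in A :|: [set x in c] by rewrite !inE cE mem_head orbT.
  case: pickP => [e /andP[eF]|/(_ a0)]; last first.
    by rewrite a0F (step_vtx ya0) vtx_id.
  rewrite (step_vtx ya0) => ea0.
  rewrite (flow_tail_inj pN cF eF a0F ea0).
  have -> : fingraph.orbit (succ_dart (A :|: [set x in c]) a0) a0 = c.
    rewrite cE; apply: (succ_dart_orbit _ _ _); rewrite -cE //.
      by move=> x xc; rewrite !inE xc orbT.
    apply: (cycle_step_succ_dart pN cF) => // x xc; by rewrite !inE xc orbT.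
  by rewrite FD catA -s1E -s'E.
rewrite /wind /q (@wind_quiet set0 [::] (take k s')) // s1E.
apply: (@quiet_intro _ _ _ a0); last exact: avoid0.
  by move: so'; rewrite cE -catA -cat_rcons => /cat_sorted2[].
by move: sepc; rewrite cE /= -cat_rcons sep_cat => /and3P[].
Qed.

(** Induction up to the first event, which exists because the run is not quiet; [sep] and [avoid] of
    the part already read are the invariants. *)
Lemma flip_run A s d p : conservative A -> dpath i j (s ++ d :: p) ->
  sep (rcons s d) -> avoid A (rcons s d) -> ~~ quiet A s (d :: p) ->
  let x := flip A s (d :: p) in
  [/\ conservative x.1, dpath i j x.2, (set_monom x.1 + pmonom x.2)%MM = (set_monom A + pmonom (s ++ d :: p))%MM,
      flip x.1 [::] x.2 = (A, s ++ d :: p) &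
      (-1 : int) ^ wind x.2 = - ((-1) ^ wind_from s (d :: p))].
Proof.
elim: p s d => [|f r IH] s d cA; rewrite -cat_rcons => dp se av nq x; move: nq @x;
  rewrite [quiet _ _ _]/= [flip _ _ _]/= [wind_from _ _]/=.
- case: pickP => [e /andP[eA ed]|_] /=.
    (* The two kinds of event exclude each other: the prefix avoids [A], so it does not contain the
       vertex where [A] is met. *)
    have noS : (find (fun a => a \in vtx (tw d)) (rcons s d) < size (rcons s d))%N = false.
      rewrite -has_find; apply/negbTE/hasPn => a aS.
      by rewrite -(vtx_same ed) vtx_sym; move/avoidP: av; apply.
    by rewrite noS => _; exact: flip_splice.
  rewrite has_find andbT negbK => ks; rewrite ks.
  have [] := flip_loop cA dp se av erefl ks => ? ? ? ? w; split => //.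
  by rewrite w sign_loop opprK.
case: pickP => [e /andP[eA ed]|nA] /=.
  have noS : (find (fun a => a \in vtx (tw d)) (rcons s d) < size (rcons s d))%N = false.
    rewrite -has_find; apply/negbTE/hasPn => a aS.
    by rewrite -(vtx_same ed) vtx_sym; move/avoidP: av; apply.
  by rewrite noS => _; exact: flip_splice.
rewrite has_find; case: ifP => ks /=.
  have [] := flip_loop cA dp se av erefl ks => ? ? ? ? w _; split => //.
  by rewrite w sign_loop opprK.
move=> nq; have df : step d f.
  have : sorted stp (rcons s d ++ f :: r) by case/dpathP: dp => p [-> _].
  by rewrite cat_rcons => /cat_sorted2[_ /=/andP[]].
apply: IH => //.
  rewrite -cats1 sep_cat se /= andbT; apply/allrelP => a b aS.
  rewrite inE => /eqP ->; rewrite -(step_vtx df).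
  by move/negbT: ks; rewrite -has_find => /hasPn; apply.
rewrite -cats1 avoid_cat av; apply/avoidP => x a; rewrite inE => /eqP -> aA.
by have := nA a; rewrite aA (step_vtx df) /= => ->.
Qed.

End Run.
End Flip.

Lemma sum_sign_involution (T : eqType) (r : seq T) (s : T -> int) (f : T -> T) : uniq r ->
  {in r, forall x, f x \in r} -> {in r, forall x, f (f x) = x} ->
  {in r, forall x, s (f x) = - s x} -> \sum_(x <- r) s x = 0.
Proof.
move=> ur fr ff sf; have e : \sum_(x <- r) s x = - \sum_(x <- r) s x.
  rewrite -sumrN -[RHS](eq_big_seq _ sf) -(big_map f xpredT s).
  apply/perm_big/uniq_perm => // [|x].
    by rewrite map_inj_in_uniq // => x y xr yr e; rewrite -[x]ff // e ff.
  apply/idP/mapP => [xr|[y yr ->]]; last exact: fr.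
  by exists (f x); rewrite ?ff ?fr.
have : (\sum_(x <- r) s x) *+ 2 == 0 by rewrite mulr2n {1}e addNr.
by rewrite mulrn_eq0 => /eqP.
Qed.

Lemma reindex_enum_val (T : finType) (U : Type) (idx : U) (op : Monoid.com_law idx) (F : T -> U) :
  \big[op/idx]_(x : T) F x = \big[op/idx]_(v < #|T|) F (enum_val v).
Proof.
rewrite (reindex (@enum_val T T)) //=.
by exists enum_rank => y _; rewrite ?enum_valK ?enum_rankK.
Qed.

(** * Boundary measurements as quotients of flow sums *)

Section Measurement.
Variables (R : realFieldType) (n : nat) (N : network R n).
Hypothesis pN : perfect N.
Local Notation tw := (twin N).
Local Notation stp := (@step R n N).
Local Notation lg := (leg N).
Implicit Types (i j : 'I_n) (d e x y z : dart N) (A F : {set dart N}) (S T : {set 'I_n}).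
Implicit Types (c p q s u r : seq (dart N)).

Definition flows S T : {set {set dart N}} :=
  [set F : {set dart N} | [&& F \subset [set d | out d],
     [forall x, internal x ==> (#|F :&: vtx x| == #|heads F x|)],
     [forall i, (lg i \in F) == (i \in S)] & [forall i, (tw (lg i) \in F) == (i \in T)]]].

Lemma flowsP S T F : reflect (isflow S T F) (F \in flows S T).
Proof.
rewrite inE; apply: (iffP and4P) => -[h1 h2 h3 h4]; split => //.
- by move=> x xi; apply/eqP; move/forallP: h2 => /(_ x); rewrite xi.
- by move=> i; apply/eqP; move/forallP: h3.
- by move=> i; apply/eqP; move/forallP: h4.
- by apply/forallP => x; apply/implyP => /h2 ->.
- by apply/forallP => i; apply/eqP.
- by apply/forallP => i; apply/eqP.
Qed.

Lemma flow_sep S T F p : isflow S T F -> uniq p -> {subset p <= F} -> sep p.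
Proof.
move=> hF; rewrite /sep; elim: p => //= d p IH /andP[dp up] sF.
have sF' : {subset p <= F} by move=> x xp; apply: sF; rewrite inE xp orbT.
rewrite IH // andbT; apply/allP => x xp; apply/negP => dx.
have dF : d \in F by apply: sF; rewrite mem_head.
by move: dp; rewrite (flow_tail_inj pN hF dF (sF' _ xp) dx) xp.
Qed.

Lemma conservative0 : conservative (set0 : {set dart N}).
Proof.
split=> [|x _|i|i]; rewrite ?sub0set ?inE //.
rewrite set0I; apply: eq_card => y; by rewrite !inE andbF.
Qed.

Section FixedEnds.
Variables (i j : 'I_n).

(* Adding the edges of a path from [b_i] to [b_j] that avoids the conservative
   flow identifies the quiet pairs with the flows from [b_i] to [b_j]. *)
Definition join (x : {set dart N} * seq (dart N)) : {set dart N} :=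
  x.1 :|: [set d in x.2].

Lemma dpath_quiet_sep A p : conservative A -> dpath i j p -> quiet A [::] p ->
  [/\ sep p, avoid A p, uniq p & [disjoint A & [set d in p]]].
Proof.
move=> cA /dpathP[q [-> io iq _]] qu.
have [||se av] := quiet_sep iq _ _ qu.
- by [].
- apply/avoidP => d a; rewrite inE => /eqP -> aA; rewrite vtx_leg inE.
  by apply: contraTneq (conservative_internal cA aA) => ->; rewrite internal_leg.
split => //; first exact: sep_uniq.
rewrite -setI_eq0; apply/eqP/setP => x; rewrite in_setI in_set in_set0.
by apply/negP => /andP[xA xp]; move/avoidP: av => /(_ x x xp xA); rewrite vtx_id.
Qed.

Lemma join_flow A p : conservative A -> dpath i j p -> quiet A [::] p ->
  isflow [set i] [set j] (join (A, p)) /\ set_monom (join (A, p)) = (set_monom A + pmonom p)%MM.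
Proof.
move=> cA dp qu; have [_ _ up dis] := dpath_quiet_sep cA dp qu.
split; last by rewrite (set_monomU dis) set_monom_seq.
by have := flowU dis cA (dpath_flow up dp); rewrite !set0U.
Qed.

(** Injectivity of [join]: the path is recovered by following the union from its initial leg, and
    the rest is [A]. *)
Lemma join_orbit A p : conservative A -> dpath i j p -> quiet A [::] p ->
  p = fingraph.orbit (succ_dart (join (A, p)) (lg i)) (lg i) /\ A = join (A, p) :\: [set d in p].
Proof.
move=> cA dp qu; have [_ _ up dis] := dpath_quiet_sep cA dp qu.
have [hF _] := join_flow cA dp qu; set F := join (A, p) in hF *.
have pF : {subset p <= F} by move=> x xp; rewrite !inE xp orbT.
split; last first.
  apply/setP => x; rewrite !inE; have := pred0P dis x; rewrite /= inE.
  by case: (x \in p) (x \in A) => [] [].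
have /dpathP[q [pE io iq lj]] := dp; rewrite pE in up pF.
rewrite [LHS]pE; apply/esym/succ_dart_orbit => //.
rewrite /= rcons_path; apply/andP; split.
  have := iq; apply: (@sub_in_path _ (mem F)); last exact/allP.
  by move=> x y xF yF xy; apply/eqP; exact: (succ_dart_step pN hF).
by rewrite /= (succ_dart_leg hF) ?eqxx ?lj ?internal_leg // pF // mem_last.
Qed.

(** Surjectivity of [join]: the only exit is at [j], so the orbit of the initial leg, closed up
    through that leg, is a path to [j], and removing it leaves a conservative flow. *)
Lemma flow_join F : isflow [set i] [set j] F ->
  exists A p, [/\ conservative A, dpath i j p, quiet A [::] p & F = join (A, p)].
Proof.
move=> hF; have [_ _ sF tF] := hF.
have iF : lg i \in F by rewrite sF inE.
have legF x : x \in F -> ~~ internal (tw x) -> tw x = lg j.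
  move=> xF /internalPn[l xl]; rewrite xl; congr (lg _); apply/eqP.
  by rewrite -in_set1 -tF -xl twinK.
have w : wraps F (lg i).
  left; split; first by exists i.
  by split=> // x y xF yF /(legF x xF) xl /(legF y yF) yl; apply: (@perm_inj _ tw); rewrite xl.
have [up sp fp [q pE]] := orbit_succ_dart pN hF w iF; rewrite pE in up sp fp.
have iq : lg i \notin q by case/andP: up.
have nxi x : x \in F -> internal (tw x) -> succ_dart F (lg i) x != lg i.
  move=> xF xi; have [_ /andP[_ /internal_vtx]] := succ_dart_internal pN hF (lg i) xF xi.
  by rewrite xi; apply: contra_eqN => /eqP ->; rewrite internal_leg.
have pathF d r : d \in F -> {subset r <= F} -> lg i \notin r ->
    fpath (succ_dart F (lg i)) d r -> path stp d r.
  elim: r d => //= f r IH d dF rF; rewrite inE negb_or => /andP[nf nr] /andP[/eqP df fr].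
  have fF : f \in F by apply: rF; rewrite mem_head.
  rewrite (IH f fF) ?andbT // => [|x xr]; last by apply: rF; rewrite inE xr orbT.
  have di : internal (tw d).
    by apply: contraNT nf => dl; rewrite -df (succ_dart_leg hF _ dF dl).
  by have [_] := succ_dart_internal pN hF (lg i) dF di; rewrite df.
move: fp; rewrite /= rcons_path => /andP[fq /eqP lq].
have pq : path stp (lg i) q.
  by apply: pathF => // x xq; apply: sp; rewrite inE xq orbT.
have lF : last (lg i) q \in F by apply: sp; exact: mem_last.
have lj : tw (last (lg i) q) = lg j.
  apply: legF => //; apply/negP => li.
  by have := nxi _ lF li; rewrite lq eqxx.
have io : out (lg i) := flow_out hF iF.
set p := lg i :: q in up sp.
have dp : dpath i j p by apply/dpathP; exists q.
have fp : isflow [set i] [set j] [set d in p] := dpath_flow up dp.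
have sub : [set d in p] \subset F by apply/subsetP => x; rewrite inE => /sp.
exists (F :\: [set d in p]), p; split => //.
- by have := flowD sub hF fp; rewrite !setDv.
- apply: quiet_last => //.
  + by move=> a; rewrite inE => /andP[_ /(flow_out hF)].
  + by move=> a; apply: path_out.
  + by rewrite lj internal_leg.
  + exact: flow_sep hF up sp.
  apply/avoidP => d a dP; rewrite !inE => /andP[ap aF]; apply: contraNN ap => ad.
  by rewrite (flow_tail_inj pN hF aF (sp _ dP) ad) -in_cons.
apply/setP => x; rewrite !inE; case: (boolP ((x == lg i) || (x \in q))) => [xp|_].
  by rewrite orbT sp // inE.
by rewrite orbF.
Qed.

Lemma wind_quiet0 A p : quiet A [::] p -> wind p = 0.
Proof. by move=> /quiet0 qu; have := wind_quiet [::] qu; rewrite cats0. Qed.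

Lemma sign_neq0 (w : int) : (-1 : int) ^ w != 0.
Proof.
have : (-1 : int) ^ w \is a GRing.unit by rewrite unitrXz // unitrN1.
by apply: contraTneq => ->; rewrite unitr0.
Qed.

Lemma flip_pair_run A p : conservative A -> dpath i j p -> ~~ quiet A [::] p ->
  let x := flip A [::] p in
  [/\ conservative x.1, dpath i j x.2, (set_monom x.1 + pmonom x.2)%MM = (set_monom A + pmonom p)%MM,
      flip x.1 [::] x.2 = (A, p) &
      (-1 : int) ^ wind x.2 = - ((-1) ^ wind p)].
Proof.
move=> cA dp; have /dpathP[q [pE io iq lj]] := dp; move: dp; rewrite pE => dp nq.
apply: flip_run => //.
apply/avoidP => d a; rewrite inE => /eqP -> aA; rewrite vtx_leg inE.
by apply: contraTneq (conservative_internal cA aA) => ->; rewrite internal_leg.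
Qed.

Lemma mdeg_pmonom p : mdeg (pmonom p) = size p.
Proof.
rewrite mdegE; under eq_bigr => v _ do rewrite mnmE.
rewrite -(reindex_enum_val _ (fun d => count_mem d p)) /=.
elim: p => [|d p IH] /=; first by rewrite big1.
rewrite big_split /= IH (bigD1 d) //= eqxx big1 ?addn0 ?add1n // => x xd.
by rewrite eq_sym (negPf xd).
Qed.

(** [meas_coef] sums over tuples whose length depends on the monomial; one list of bounded sequences
    serves all coefficients in a convolution. *)
Definition short_seqs M : seq (seq (dart N)) := map val (enum {: M.-bseq (dart N)}).

Lemma short_seqs_uniq M : uniq (short_seqs M).
Proof. by rewrite map_inj_uniq ?enum_uniq //; exact: val_inj. Qed.

Lemma mem_short_seqs M p : (p \in short_seqs M) = (size p <= M)%N.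
Proof.
apply/mapP/idP => [[q _ ->]|pM]; first exact: size_bseq.
by exists (Bseq pM); rewrite ?mem_enum.
Qed.

Lemma meas_coef_short_seqs m M : (mdeg m <= M)%N -> @meas_coef R n N i j m =
  \sum_(p <- short_seqs M | dpath i j p && (pmonom p == m)) (-1) ^ wind p.
Proof.
move=> mM; rewrite /meas_coef.
rewrite -(big_map (@tval (mdeg m) (dart N)) (fun p => dpath i j p && (pmonom p == m))
  (fun p => (-1 : int) ^ wind p)).
rewrite -big_filter -[RHS]big_filter; apply/perm_big/uniq_perm.
- rewrite filter_uniq // map_inj_uniq ?index_enum_uniq //; exact: val_inj.
- by rewrite filter_uniq // short_seqs_uniq.
move=> p; rewrite !mem_filter mem_short_seqs; case: eqP => [pm|]; last by rewrite andbF.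
rewrite andbT; case: (dpath i j p) => //=.
have sz : size p = mdeg m by rewrite -pm mdeg_pmonom.
rewrite sz mM; apply/mapP; exists (@Tuple _ _ p (introT eqP sz)) => //.
exact: mem_index_enum.
Qed.

Definition flow_poly S T : {mpoly int[#|dart N|]} := \sum_(F in flows S T) 'X_[set_monom F].

Lemma flow_poly_coef S T m : (flow_poly S T)@_m = #|[set F in flows S T | set_monom F == m]|%:R.
Proof.
rewrite /flow_poly raddf_sum /=; under eq_bigr => F _ do rewrite mcoeffX.
rewrite -(sum1_card (mem [set F in _ | _])) natr_sum big_mkcond [RHS]big_mkcond /=; apply: eq_bigr => F _.
by rewrite [in RHS]in_set; case: (F \in flows S T) => //=; case: (set_monom F == m).
Qed.

Definition walk_pairs m : seq ({set dart N} * seq (dart N)) :=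
  [seq x <- [seq (A, p) | A <- enum (flows set0 set0), p <- short_seqs (mdeg m)]
   | dpath i j x.2 && ((set_monom x.1 + pmonom x.2)%MM == m)].

Lemma walk_pairs_uniq m : uniq (walk_pairs m).
Proof.
by rewrite filter_uniq // allpairs_uniq ?enum_uniq ?short_seqs_uniq // => -[? ?] [? ?].
Qed.

Lemma mem_walk_pairs m A p : reflect
  [/\ conservative A, dpath i j p & (set_monom A + pmonom p)%MM = m] ((A, p) \in walk_pairs m).
Proof.
rewrite mem_filter /=; apply: (iffP andP).
  case=> /andP[dp /eqP mE] /allpairsP[[A' p'] /= [+ _ [eA _]]].
  by rewrite mem_enum -eA => /flowsP.
case=> cA dp mE; split; first by rewrite dp mE eqxx.
apply/allpairsP; exists (A, p); split => //=.
  by rewrite mem_enum; apply/flowsP.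
by rewrite mem_short_seqs -mE mdegD mdeg_pmonom leq_addl.
Qed.

(** The pairs that are not quiet cancel under [flip]; the quiet ones have index 0 and correspond to
    flows through [join]. *)
Lemma sum_walk_pairs m : \sum_(x <- walk_pairs m) (-1 : int) ^ wind x.2 =
  (flow_poly [set i] [set j])@_m.
Proof.
rewrite (bigID (fun t => quiet t.1 [::] t.2)) /= [X in _ + X](_ : _ = 0) ?addr0; last first.
  rewrite -big_filter; apply: (@sum_sign_involution _ _ _ (fun t => flip t.1 [::] t.2)).
  - by rewrite filter_uniq // walk_pairs_uniq.
  - move=> [A p]; rewrite mem_filter /= => /andP[nq /mem_walk_pairs[cA dp mE]].
    have [] := flip_pair_run cA dp nq; case fE : (flip _ _ _) => [A' p'] /= cA' dp' mE' ff w.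
    rewrite mem_filter /=; apply/andP; split; last first.
      by apply/mem_walk_pairs; split => //; rewrite mE'.
    (* [flip] returns a quiet pair unchanged. A quiet image would therefore equal the original pair,
       against the change of sign. *)
    apply/negP => qu; have := flip_quiet [::] qu; rewrite cats0 ff /= => -[_ e].
    move: w; rewrite e => /eqP; rewrite -addr_eq0 -mulr2n mulrn_eq0 /=.
    by apply/negP; exact: sign_neq0.
  - move=> [A p]; rewrite mem_filter /= => /andP[nq /mem_walk_pairs[cA dp mE]].
    by have [] := flip_pair_run cA dp nq.
  move=> [A p]; rewrite mem_filter /= => /andP[nq /mem_walk_pairs[cA dp mE]].
  by have [] := flip_pair_run cA dp nq.
rewrite flow_poly_coef -big_filter.
rewrite (eq_big_seq (fun _ => 1)); last first.
  by move=> [A p]; rewrite mem_filter /= => /andP[/wind_quiet0 -> _].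
rewrite big_const_seq count_predT iter_addr addr0; congr (_%:R).
set rq := filter _ _.
have urq : uniq rq by apply: filter_uniq; exact: walk_pairs_uniq.
rewrite -(size_map join) cardE; apply/perm_size/uniq_perm.
- rewrite map_inj_in_uniq // => -[A p] [A' p'].
  rewrite mem_filter /= => /andP[qu /mem_walk_pairs[cA dp _]].
  rewrite mem_filter /= => /andP[qu' /mem_walk_pairs[cA' dp' _]] e.
  have [e1 e2] := join_orbit cA dp qu; have [e1' e2'] := join_orbit cA' dp' qu'.
  have pp : p = p' by rewrite e1 e1' e.
  by rewrite e2 e2' e pp.
- exact: enum_uniq.
move=> F; rewrite mem_enum inE; apply/mapP/andP.
  case=> [[A p]]; rewrite mem_filter /= => /andP[qu /mem_walk_pairs[cA dp mE]] ->.
  have [h1 h2] := join_flow cA dp qu; rewrite h2 mE eqxx; split => //.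
  exact/flowsP.
case=> /flowsP/flow_join[A [p [cA dp qu FE]]] /eqP mE.
exists (A, p) => //; rewrite mem_filter /= qu; apply/mem_walk_pairs; split => //.
by have [_ <-] := join_flow cA dp qu; rewrite -FE.
Qed.

Lemma flow_poly_sums : sums_to (@meas_coef R n N i j)
  (flow_poly [set i] [set j]) (flow_poly set0 set0).
Proof.
move=> m; rewrite -sum_walk_pairs; set g := flow_poly set0 set0.
(* The condition is written with a sum, so that a monomial [a] not dividing [m] gives 0 without
   truncated subtraction. *)
pose S a := \sum_(p <- short_seqs (mdeg m) | dpath i j p && ((a + pmonom p)%MM == m)) (-1 : int) ^ wind p.
have SE a : (a <= m)%MM -> @meas_coef R n N i j (m - a)%MM = S a.
  move=> am; rewrite (@meas_coef_short_seqs _ (mdeg m)); last first.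
    by rewrite -{2}(submK am) mdegD leq_addr.
  apply: eq_bigl => p; congr andb; apply/eqP/eqP => [->|<-]; first by rewrite addmC submK.
  by rewrite addmC addmK.
have S0 a : ~~ (a <= m)%MM -> S a = 0.
  move=> am; rewrite /S big1_seq // => p /andP[/andP[_ /eqP e] _].
  by rewrite -e lem_addr in am.
transitivity (\sum_(A in flows set0 set0) S (set_monom A)).
  rewrite /walk_pairs big_filter big_mkcond big_allpairs_dep big_enum /=.
  by apply: eq_bigr => A _; rewrite /S [RHS]big_mkcond.
rewrite [RHS]big_mkcond /=.
transitivity (\sum_(a <- msupp g) \sum_(A in flows set0 set0) (set_monom A == a)%:R * S (set_monom A)).
  rewrite exchange_big /=; apply: eq_bigr => A Aflow.
  have Ag : set_monom A \in msupp g.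
    rewrite mcoeff_msupp flow_poly_coef pnatr_eq0 -lt0n card_gt0.
    by apply/set0Pn; exists A; rewrite inE Aflow eqxx.
  rewrite (bigD1_seq (set_monom A)) ?msupp_uniq //= eqxx mul1r big1 ?addr0 // => a na.
  by rewrite eq_sym (negPf na) mul0r.
apply: eq_big_seq => a _.
transitivity (g@_a * S a).
  rewrite /g /flow_poly raddf_sum mulr_suml; apply: eq_bigr => A _ /=.
  by rewrite mcoeffX; case: eqP => [->|]; rewrite ?mul0r.
by case: ifP => am; [rewrite SE | rewrite S0 ?am // mulr0].
Qed.

End FixedEnds.

Lemma flow_poly_subtraction_free S T : subtraction_free (flow_poly S T).
Proof. by move=> m; rewrite flow_poly_coef ler0n. Qed.

Lemma conservative_poly_neq0 : flow_poly set0 set0 != 0.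
Proof.
apply/eqP => /(congr1 (fun f : {mpoly _[_]} => f@_(set_monom set0))) /eqP.
rewrite flow_poly_coef mcoeff0 pnatr_eq0 -leqn0 leqNgt card_gt0.
by case/negP; apply/set0Pn; exists set0; rewrite inE eqxx andbT; apply/flowsP; exact: conservative0.
Qed.

Lemma eval_flow_poly S T : eval_weights (flow_poly S T) =
  \sum_(F in flows S T) \prod_(d in F) weight d.
Proof.
rewrite /eval_weights /flow_poly (rmorph_sum (map_mpoly intr)) rmorph_sum.
apply: eq_bigr => F _.
rewrite /= map_mpolyX mevalX [RHS]big_mkcond /=.
rewrite [RHS]reindex_enum_val /=.
by apply: eq_bigr => v _; rewrite mnmE; case: (_ \in F).
Qed.

End Measurement.

(** * Independence of the fraction that represents the series *)

Section FormalSums.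
Variable (v : nat).
Implicit Types (f g p q : {mpoly int[v]}) (S : 'X_{1..v} -> int) (m a b : 'X_{1..v}).

Lemma mcoeffM_supp p q m :
  (p * q)@_m = \sum_(b <- msupp q | (b <= m)%MM) q@_b * p@_(m - b)%MM.
Proof.
rewrite {1}[q]mpolyE mulr_sumr raddf_sum [RHS]big_mkcond /=; apply: eq_big_seq => b _.
rewrite -scalerAr mcoeffZ; case: ifP => bm.
  by rewrite -{1}(submK bm) addmC mcoeffMX.
have [->|nz] := eqVneq ((p * 'X_[b])@_m) 0; first by rewrite mulr0.
move: nz; rewrite -mcoeff_msupp (perm_mem (msuppMX _ _)) => /mapP[c _ e].
by move: bm; rewrite e lem_addr.
Qed.

(** Both sides are the product of [g], [g'] and the series; [t] is the term of the double sum, which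
    is taken in either order. *)
Lemma sums_to_cross S f g f' g' : sums_to S f g -> sums_to S f' g' -> f * g' = f' * g.
Proof.
move=> h h'; apply/mpolyP => m; rewrite !mcoeffM_supp.
have le2 a b : (b <= m)%MM && (a <= m - b)%MM = (a + b <= m)%MM.
  apply/andP/mnm_lepP => [[/mnm_lepP bm /mnm_lepP am] i|abm].
    by have := bm i; have := am i; rewrite mnmDE mnmBE; lia.
  by split; apply/mnm_lepP => i; have := abm i; rewrite mnmDE ?mnmBE; lia.
pose t a b := if (a + b <= m)%MM then g@_a * g'@_b * S (m - (a + b))%MM else 0.
have E1 b : (if (b <= m)%MM then g'@_b * f@_(m - b)%MM else 0) = \sum_(a <- msupp g) t a b.
  case: ifP => bm; last first.
    by rewrite big1 // => a _; rewrite /t -le2 bm.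
  rewrite h mulr_sumr big_mkcond /=; apply: eq_bigr => a _.
  rewrite /t -le2 bm /=; case: ifP => // _.
  by rewrite submDA [(b + a)%MM]addmC mulrA [g'@_b * _]mulrC.
have E2 a : (if (a <= m)%MM then g@_a * f'@_(m - a)%MM else 0) = \sum_(b <- msupp g') t a b.
  case: ifP => am; last first.
    by rewrite big1 // => b _; rewrite /t addmC -le2 am.
  rewrite h' mulr_sumr big_mkcond /=; apply: eq_bigr => b _.
  by rewrite /t addmC -le2 am /=; case: ifP => // _; rewrite submDA mulrA addmC.
rewrite big_mkcond [RHS]big_mkcond /=.
under eq_bigr => b _ do rewrite E1.
under [RHS]eq_bigr => a _ do rewrite E2.
exact: exchange_big.
Qed.

End FormalSums.

Lemma eval_weights_gt0 (R : realFieldType) (n : nat) (N : network R n) g :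
  subtraction_free g -> g != 0 -> 0 < eval_weights (N := N) g.
Proof.
move=> gf g0; rewrite /eval_weights mevalE.
have pos m : 0 <= (map_mpoly intr g)@_m :> R by rewrite mcoeff_map_mpoly ler0z.
have : msupp (map_mpoly (intr : int -> R) g) != [::].
  rewrite msupp_eq0; apply: contra g0 => /eqP e; apply/eqP/mpolyP => m.
  have := congr1 (fun p : {mpoly R[_]} => p@_m) e.
  rewrite mcoeff_map_mpoly !mcoeff0 => /eqP; rewrite intr_eq0 => /eqP ->.
  by [].
case sE : (msupp _) => [//|m s] _; rewrite big_cons ltr_wpDr //.
  apply: sumr_ge0 => a _; apply: mulr_ge0 => //; apply: prodr_ge0 => v _.
  by rewrite exprn_ge0 // ltW // weight_gt0.
rewrite mulr_gt0 //; last by apply: prodr_gt0 => v _; rewrite exprn_gt0 // weight_gt0.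
by rewrite lt_def pos andbT -mcoeff_msupp sE mem_head.
Qed.

Lemma boundary_measurement_unique (R : realFieldType) (n : nat) (N : network R n) i j r r' :
  boundary_measurement N i j r -> boundary_measurement N i j r' -> r = r'.
Proof.
case=> f [g [_ gf g0 h ->]] [f' [g' [_ gf' g0' h' ->]]].
have e := sums_to_cross h h'.
have : eval_weights (N := N) (f * g') = eval_weights (f' * g) by rewrite e.
rewrite /eval_weights !rmorphM /= -!/(eval_weights _) => ee.
have n1 : eval_weights (N := N) g != 0 by rewrite gt_eqF // eval_weights_gt0.
have n2 : eval_weights (N := N) g' != 0 by rewrite gt_eqF // eval_weights_gt0.
by apply/eqP; rewrite eqr_div //; apply/eqP.
Qed.

(** * Flows as sets of edges to reverse *)

Section FlowsReorient.
Variables (R : realFieldType) (n : nat) (N : network R n).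
Local Notation tw := (twin N).
Local Notation lg := (leg N).
Implicit Types (i j : 'I_n) (d x : dart N) (F O : {set dart N}) (J : {set 'I_n}).

(** A reversed edge is represented in an orientation by its dart that is not [out] in [N], so the
    weight of an orientation is the product over its reversed edges. *)
Definition reversal_weight d : R := if out d then 1 else weight d.

Definition reversed O : {set dart N} := [set d | out d & d \notin O].
Definition reversal F : {set dart N} := [set d | if out d then d \notin F else tw d \in F].

Lemma orient_weight_reversed O J : O \in reorient N J -> orient_weight reversal_weight O = \prod_(d in reversed O) weight d.
Proof.
case/reorientP => tO _ _; rewrite /orient_weight big_mkcond [RHS]big_mkcond /=.
rewrite (reindex_inj (@perm_inj _ tw)) /=; apply: eq_bigr => d _.
by rewrite tO inE /reversal_weight out_twin weight_twin; case: (out d); case: (d \in O).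
Qed.

Lemma reversed_reversal F : (reversed (reversal F) == F) = (F \subset [set d | out d]).
Proof.
have -> : reversed (reversal F) = F :&: [set d | out d].
  by apply/setP => d; rewrite !inE; case: (out d); rewrite ?andbT ?andbF ?negbK.
exact/eqP/setIidPl.
Qed.

Lemma reversalK O J : O \in reorient N J -> reversal (reversed O) = O.
Proof.
case/reorientP => tO _ _; apply/setP => d; rewrite !inE out_twin tO.
by case: (out d); case: (d \in O).
Qed.

(** Reversal removes the tails of [F] from the outgoing darts and adds its heads; hence outdegrees
    are preserved exactly when [F] is balanced. *)
Lemma card_reversal F x : F \subset [set d | out d] ->
  (#|reversal F :&: vtx x| + #|F :&: vtx x| = outdegree x + #|heads F x|)%N.
Proof.
move=> /subsetP oF; have out_heads y : y \in heads F x -> ~~ out y.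
  by rewrite inE => /andP[_ /oF]; rewrite inE out_twin.
pose U := [set y in vtx x | out y].
have FU : F :&: vtx x = U :&: F.
  apply/setP => y; rewrite !inE andbC; have [/oF|] := boolP (y \in F); last by rewrite !andbF.
  by rewrite inE => ->; rewrite !andbT.
have -> : reversal F :&: vtx x = (U :\: F) :|: heads F x.
  apply/setP => y; rewrite !inE; have [yv|] := boolP (y \in vtx x); last by rewrite !andbF.
  rewrite !andbT /=; have [oy|oy] := boolP (out y); last by rewrite andbF.
  rewrite andbT; apply/esym/orb_idr => tF.
  by have := oF _ tF; rewrite inE out_twin oy.
rewrite cardsU (_ : _ :&: heads F x = set0) ?cards0 ?subn0; last first.
  apply/setP => y; rewrite in_setI in_set0; apply/negP => /andP[+ /out_heads].
  by rewrite !inE => /and3P[_ _ ->].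
by rewrite FU addnAC [(#|U :\: F| + _)%N]addnC cardsID.
Qed.

Lemma reversal_reorient F J : F \subset [set d | out d] ->
  (reversal F \in reorient N J) = (F \in flows N (sources N :\: J) (J :\: sources N)).
Proof.
move=> oF; have oF' := subsetP oF.
apply/reorientP/flowsP; last case=> h1 h2 h3 h4.
  case=> h1 h2 h3.
  split=> // [x xi|i|i].
  - by apply/eqP; rewrite -(eqn_add2l (outdegree x)) -card_reversal // h2.
  - have := h3 i; rewrite !inE; have [oi|oi] := boolP (out (lg i)).
      by move=> <-; rewrite negbK andbT.
    by rewrite andbF => _; apply/negbTE/negP => /oF'; rewrite inE (negPf oi).
  have := h3 i; rewrite !inE; have [oi|oi] := boolP (out (lg i)).
    by move=> _; apply/negbTE/negP => /oF'; rewrite inE out_twin oi.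
  by move=> ->; rewrite andTb.
split=> [d|x xi|i].
- rewrite !inE out_twin twinK; case oi : (out d) => /=; rewrite ?negbK //.
- by apply/eqP; rewrite -(eqn_add2r #|F :&: vtx x|) card_reversal // h2.
rewrite !inE; have := h3 i; have := h4 i; rewrite !inE.
have [_ _|_ -> _] := boolP (out (lg i)); last by [].
by move=> ->; rewrite andbT negbK.
Qed.

Lemma orient_sum_flows J : orient_sum reversal_weight J = \sum_(F in flows N (sources N :\: J) (J :\: sources N))
  \prod_(d in F) weight d.
Proof.
rewrite /orient_sum (reindex_onto reversal reversed) /=; last by move=> O; exact: reversalK.
apply: eq_big => [F|F /andP[hO /eqP e]]; last by rewrite (orient_weight_reversed hO) e.
rewrite reversed_reversal; apply/andP/idP => [[h oF]|h]; first by rewrite -reversal_reorient.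
by have /flowsP[oF _ _ _] := h; rewrite reversal_reorient.
Qed.

Hypothesis pN : perfect N.

Lemma boundary_measurement_orient_sum i j : i \in sources N -> j \notin sources N ->
  boundary_measurement N i j (orient_sum reversal_weight (j |: (sources N :\ i)) / orient_sum reversal_weight (sources N)).
Proof.
move=> iI jI; exists (flow_poly N [set i] [set j]), (flow_poly N set0 set0); split.
- exact: flow_poly_subtraction_free.
- exact: flow_poly_subtraction_free.
- exact: conservative_poly_neq0.
- exact: flow_poly_sums.
rewrite !eval_flow_poly !orient_sum_flows setDv.
have nij : i != j by apply: contraNneq jI => <-.
congr (_ / _); apply: eq_bigl => F; congr (F \in flows N _ _); apply/setP => l; rewrite !inE.
- have [->|li] := eqVneq l i; first by move: iI; rewrite (negPf nij) inE => ->.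
  by case: (l == j) => //=; case: (out _).
have [->|lj] := eqVneq l j; first by move: jI; rewrite inE => ->.
by case: (l == i) => //=; case: (out _).
Qed.

End FlowsReorient.

(** * Comparison of the two networks *)

Section ThreeTermSigns.
Variables (R : comRingType) (n : nat) (G : 'I_n -> 'I_n -> R) (P : pred 'I_n).
Hypothesis anti : forall u v, G u v = - G v u.

Definition three_term u v w z := G u v * G w z - G u w * G v z + G u z * G v w.

Hypothesis sorted3 : forall u v w z : 'I_n, (u < v)%N -> (v < w)%N -> (w < z)%N ->
  P u -> P v -> P w -> P z -> three_term u v w z = 0.

(** By antisymmetry the expression changes sign under adjacent transpositions, so its vanishing on
    increasing indices extends to any order by sorting. *)
Lemma three_term_swap u v w z : three_term u v w z = 0 ->
  [/\ three_term v u w z = 0, three_term u w v z = 0 & three_term u v z w = 0].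
Proof.
rewrite /three_term => e; split.
- rewrite (anti v u); move: e => /(congr1 -%R); rewrite oppr0 => <-; ring.
- rewrite (anti w v); move: e => /(congr1 -%R); rewrite oppr0 => <-; ring.
rewrite (anti z w); move: e => /(congr1 -%R); rewrite oppr0 => <-; ring.
Qed.

Lemma three_term_uniq u v w z : uniq [:: u; v; w; z] ->
  P u -> P v -> P w -> P z -> three_term u v w z = 0.
Proof.
rewrite /= !inE !negb_or andbT => /and3P[/and3P[uv uw uz] /andP[vw vz] wz].
have lt (a b : 'I_n) : a != b -> (a < b)%N \/ (b < a)%N.
  by move=> ab; apply/orP; rewrite -neq_ltn (inj_eq val_inj).
have s1 a b c d : three_term a b c d = 0 -> three_term b a c d = 0 by case/three_term_swap.
have s2 a b c d : three_term a b c d = 0 -> three_term a c b d = 0 by case/three_term_swap.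
have s3 a b c d : three_term a b c d = 0 -> three_term a b d c = 0 by case/three_term_swap.
(* Insertion of the last index into three sorted ones; [t2] does the same for the third. *)
have t3 (a b c d : 'I_n) : (a < b)%N -> (b < c)%N -> a != d -> b != d -> c != d ->
    P a -> P b -> P c -> P d -> three_term a b c d = 0.
  move=> ab bc /lt ad /lt bd /lt cd Pa Pb Pc Pd.
  case: cd => [cd|dc]; first exact: sorted3.
  apply: s3; case: bd => [bd|db]; first exact: sorted3.
  apply: s2; case: ad => [ad|da]; first exact: sorted3.
  by apply: s1; exact: sorted3.
have t2 (a b c d : 'I_n) : (a < b)%N -> uniq [:: a; b; c; d] ->
    P a -> P b -> P c -> P d -> three_term a b c d = 0.
  rewrite /= !inE !negb_or andbT => ab /and3P[/and3P[_ ac ad] /andP[bc bd] cd] Pa Pb Pc Pd.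
  case: (lt _ _ bc) => [bc'|cb]; first exact: t3.
  apply: s2; case: (lt _ _ ac) => [ac'|ca]; first exact: t3.
  by apply: s1; exact: t3.
have U : uniq [:: u; v; w; z] by rewrite /= !inE !negb_or uv uw uz vw vz wz.
case: (lt _ _ uv) => [uv'|vu] Pu Pv Pw Pz; first exact: t2.
apply: s1; apply: t2 => //.
by rewrite /= !inE !negb_or eq_sym uv uw uz vw vz wz.
Qed.

End ThreeTermSigns.

Lemma plucker_three_term_card (R : realFieldType) (k n : nat) (K : {set 'I_n})
    (X : grassmannian R k n) (u v w z : 'I_n) : k = #|K|.+2 -> uniq [:: u; v; w; z] ->
  u \notin K -> v \notin K -> w \notin K -> z \notin K -> plucker X (u |: (v |: K)) != 0 ->
  let G (a b : 'I_n) := Num.sg (b%:R - a%:R : R) * plucker X (a |: (b |: K)) in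
  G u v * G w z - G u w * G v z + G u z * G v w = 0.
Proof. by move=> e; subst k; exact: plucker_three_term. Qed.

(** Subtracting the z-relation, scaled by (x/z)^2, from the x-relation leaves a nonzero multiple of
    x2 - z2 x / z. *)
Lemma ratio_three_term (R : fieldType) (x1 x2 x3 x4 x5 x6 z1 z2 z3 z4 z5 z6 x z : R)
    (s1 s2 s3 s4 s5 s6 : R) : z1 != 0 -> z != 0 -> x != 0 -> s1 != 0 -> s2 != 0 ->
  x1 * z = z1 * x -> x3 * z = z3 * x -> x4 * z = z4 * x -> x5 * z = z5 * x -> x6 * z = z6 * x ->
  (s1 * x1) * (s2 * x2) - (s3 * x3) * (s4 * x4) + (s5 * x5) * (s6 * x6) = 0 ->
  (s1 * z1) * (s2 * z2) - (s3 * z3) * (s4 * z4) + (s5 * z5) * (s6 * z6) = 0 ->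
  x2 * z = z2 * x.
Proof.
move=> z1n zn xn s1n s2n e1 e3 e4 e5 e6 ex ez.
have E a b : a * z = b * x -> a = b * x / z by move=> <-; rewrite mulfK.
pose L a1 a2 a3 a4 a5 a6 :=
  (s1 * a1) * (s2 * a2) - (s3 * a3) * (s4 * a4) + (s5 * a5) * (s6 * a6).
have : s1 * z1 * s2 * (x / z) * (x2 - z2 * x / z) = 0.
  have <- : L x1 x2 x3 x4 x5 x6 - (x / z) ^+ 2 * L z1 z2 z3 z4 z5 z6 = 0.
    by rewrite /L ex ez mulr0 subr0.
  by rewrite /L (E _ _ e1) (E _ _ e3) (E _ _ e4) (E _ _ e5) (E _ _ e6); field.
move/eqP; rewrite !mulf_eq0 invr_eq0 (negPf s1n) (negPf z1n) (negPf s2n) (negPf xn) (negPf zn) /=.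
by rewrite subr_eq0 => /eqP ->; rewrite mulfVK.
Qed.

(** * From the chart at I to the charts at other source sets *)

Section SameNetwork.
Variables (R : realFieldType) (k n : nat) (N : network R n).
Hypothesis pN : perfect N.
Hypothesis hk : #|sources N| = k.
Local Notation I := (sources N).
Implicit Types (i j p q a b : 'I_n) (J K T : {set 'I_n}) (X : grassmannian R k n).
Local Notation Zw := (orient_sum (N := N) (reversal_weight (N := N))).

Definition realizes X J := plucker X J * Zw I = Zw J * plucker X I.

Definition realizes_near X J := [/\ #|J| = k, realizes X J &
  forall i j, i \in J -> j \notin J -> realizes X (j |: (J :\ i))].

Lemma orient_sum_gt0 J O : O \in reorient N J -> 0 < Zw J.
Proof.
have wt0 A : 0 < orient_weight (reversal_weight (N := N)) A.
  by apply: prodr_gt0 => d _; rewrite /reversal_weight; case: ifP => _; rewrite ?ltr01 ?weight_gt0.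
move=> OJ; rewrite /orient_sum (bigD1 O) //= ltr_pwDl // sumr_ge0 // => A _; exact: ltW.
Qed.

Lemma orient_sum_sources_gt0 : 0 < Zw I.
Proof. exact: orient_sum_gt0 (reorient_self N). Qed.

Definition signed_orient_sum K (u w : 'I_n) := Num.sg (w%:R - u%:R : R) * Zw (u |: (w |: K)).

Lemma orient_sum_three_term_uniq K (u v w z : 'I_n) : uniq [:: u; v; w; z] ->
  u \notin K -> v \notin K -> w \notin K -> z \notin K ->
  signed_orient_sum K u v * signed_orient_sum K w z - signed_orient_sum K u w * signed_orient_sum K v z + signed_orient_sum K u z * signed_orient_sum K v w = 0.
Proof.
apply: (@three_term_uniq _ _ (signed_orient_sum K) [pred x | x \notin K]).
  by move=> a b; rewrite /signed_orient_sum setUCA -mulNr -sgrN opprB.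
move=> p q r s; rewrite /= => pq qr rs pK qK rK sK.
have sg1 a (b : 'I_n) : (a < b)%N -> signed_orient_sum K a b = Zw (a |: (b |: K)).
  by move=> ab; rewrite /signed_orient_sum gtr0_sg ?mul1r // subr_gt0 ltr_nat.
have pr := ltn_trans pq qr; have qs := ltn_trans qr rs; have ps := ltn_trans pq qs.
by rewrite /three_term !sg1 // (orient_sum_three_term pN _ pq qr rs) // opprD addrA subrr add0r addNr.
Qed.

(** [0 < Zw J] makes the Plucker coordinate at [J] nonzero, which permits solving a three-term
    relation for the coordinates two exchanges away from [J]. *)
Lemma realizes_step X J p q : plucker X I != 0 -> realizes_near X J ->
  0 < Zw J -> p \notin J -> q \in J -> realizes_near X (p |: (J :\ q)).
Proof.
move=> XI [cJ hJ nJ] zJ pJ qJ.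
have npq : p != q by apply: contraNneq pJ => ->.
split.
- by rewrite cardsU1 !inE (negPf pJ) andbF -cJ (cardsD1 q J) qJ.
- exact: nJ.
(* An exchange in the new set leads back to [J], to a neighbour of [J], or to [b], [p] and [K] with
   [J] equal to [q], [a] and [K]. Only the last case needs the relation for q, a, p, b. *)
move=> a b; rewrite !inE negb_or negb_and negbK => /orP[/eqP ->|/andP[aq aJ]] /andP[bp bJ].
  have [->|bq] := eqVneq b q.
    rewrite (_ : q |: _ = J) //; apply/setP => x; rewrite !inE.
    have [->|xq] := eqVneq x q; rewrite ?qJ //=.
    by have [->|xp] := eqVneq x p; rewrite //= (negPf pJ).
  rewrite (negPf bq) /= in bJ.
  rewrite (_ : b |: _ = b |: (J :\ q)); first exact: nJ.
  apply/setP => x; rewrite !inE; case: (x == b) => //=.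
  by have [->|xp] := eqVneq x p; rewrite //= (negPf pJ) andbF.
have ap : a != p by apply: contraNneq pJ => <-.
have [bq|bq] := eqVneq b q.
  rewrite (_ : b |: _ = p |: (J :\ a)); first exact: nJ.
  rewrite bq; apply/setP => x; rewrite !inE.
  have [->|xq] := eqVneq x q; first by rewrite (eq_sym q a) (negPf aq) qJ orbT.
  by have [->|xp] := eqVneq x p; rewrite //= (eq_sym p a) (negPf ap).
rewrite (negPf bq) /= in bJ.
have ab : a != b by apply: contraNneq bJ => <-.
set K := J :\ q :\ a.
have cK : k = #|K|.+2.
  by rewrite -cJ (cardsD1 q J) qJ (cardsD1 a (J :\ q)) !inE aq aJ.
have JE : J = q |: (a |: K).
  apply/setP => x; rewrite !inE; have [->|_] := eqVneq x q; first by rewrite qJ.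
  by have [->|_] := eqVneq x a; rewrite ?aJ.
have pbE : b |: ((p |: (J :\ q)) :\ a) = p |: (b |: K).
  apply/setP => x; rewrite !inE; have [->|_] := eqVneq x p; first by rewrite (eq_sym p a) (negPf ap) orbT.
  by case: (x == b).
have qpE : p |: (J :\ a) = q |: (p |: K).
  apply/setP => x; rewrite !inE; have [->|_] := eqVneq x q; first by rewrite qJ (eq_sym q a) (negPf aq) orbT.
  by case: (x == p).
have qbE : b |: (J :\ a) = q |: (b |: K).
  apply/setP => x; rewrite !inE; have [->|_] := eqVneq x q; first by rewrite qJ (eq_sym q a) (negPf aq) orbT.
  by case: (x == b).
have abE : b |: (J :\ q) = a |: (b |: K).
  apply/setP => x; rewrite !inE; have [->|_] := eqVneq x a; first by rewrite aJ aq orbT.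
  by case: (x == b).
have apE : p |: (J :\ q) = a |: (p |: K).
  apply/setP => x; rewrite !inE; have [->|_] := eqVneq x a; first by rewrite aJ aq orbT.
  by case: (x == p).
have qK : q \notin K by rewrite !inE eqxx andbF.
have aK : a \notin K by rewrite !inE eqxx.
have pK : p \notin K by rewrite !inE (negPf pJ) !andbF.
have bK : b \notin K by rewrite !inE (negPf bJ) !andbF.
have uq : uniq [:: q; a; p; b].
  by rewrite /= !inE !negb_or eq_sym aq (eq_sym q p) npq (eq_sym q b) bq ap ab eq_sym bp.
have XJ : plucker X J != 0.
  have ZI0 : Zw I != 0 by rewrite gt_eqF // orient_sum_sources_gt0.
  apply: contraTneq (mulf_neq0 (lt0r_neq0 zJ) XI) => e.
  by rewrite -hJ e mul0r eqxx.
have r1 := nJ _ _ aJ pJ; have r2 := nJ _ _ aJ bJ; have r3 := nJ _ _ qJ bJ; have r4 := nJ _ _ qJ pJ.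
rewrite qpE in r1; rewrite qbE in r2; rewrite abE in r3; rewrite apE in r4.
rewrite pbE; have r0 := hJ; rewrite JE in r0 XJ zJ.
have zt := orient_sum_three_term_uniq uq qK aK pK bK.
have xt := plucker_three_term_card cK uq qK aK pK bK XJ.
have sg0 c (d : 'I_n) : c != d -> Num.sg (d%:R - c%:R : R) != 0.
  by move=> cd; rewrite sgr_eq0 subr_eq0 eqr_nat eq_sym (inj_eq val_inj).
rewrite /realizes; apply: (ratio_three_term _ _ _ _ _ r0 r1 r3 r2 r4 xt zt) => //.
- by rewrite gt_eqF.
- by rewrite gt_eqF // orient_sum_sources_gt0.
- by apply: sg0; rewrite eq_sym.
- by apply: sg0; rewrite eq_sym.
Qed.


(** Induction on the distance to I: [source_exchange] produces an orientation whose source set is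
    closer to I, so its sum is positive and [realizes_step] applies. *)
Lemma realizes_near_reorient X J C : plucker X I != 0 ->
  (forall i j, i \in I -> j \notin I -> realizes X (j |: (I :\ i))) ->
  C \in reorient N J -> realizes_near X J.
Proof.
move=> XI near; have [m] := ubnP #|J :\: I|; elim: m J C => // m IH J C.
rewrite ltnS => Jm CJ.
have [|/set0Pn[p]] := boolP (J :\: I == set0).
  rewrite setD_eq0 => JI; suff -> : J = I by split; rewrite // /realizes mulrC.
  apply/eqP; rewrite eqEsubset JI /=; apply/subsetP => p pI; apply/negPn/negP => pJ.
  have [q [qJ qI]] := sink_exchange pN CJ (reorient_self N) pI pJ.
  by rewrite (subsetP JI) in qI.
rewrite inE => /andP[pI pJ].
have [q [qI qJ [D DJ]]] := source_exchange pN CJ (reorient_self N) pJ pI.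
have nqp : q != p by apply: contraNneq qJ => ->.
have JE : J = p |: ((q |: (J :\ p)) :\ q).
  apply/setP => x; rewrite !inE; have [->|xp] := eqVneq x p; first by rewrite pJ.
  by have [->|xq] := eqVneq x q; rewrite //= (negPf qJ).
rewrite JE; apply: realizes_step => //.
- apply: IH DJ; apply: leq_trans Jm; apply: proper_card; apply/properP; split.
    apply/subsetP => x; rewrite !in_setD in_setU1 in_setD1.
    by case/andP => xI /predU1P[xq|/andP[_ ->]]; [rewrite xq qI in xI | rewrite xI].
  exists p; first by rewrite in_setD pI.
  by rewrite in_setD in_setU1 in_setD1 eqxx (eq_sym p q) (negPf nqp) andbF.
- exact: orient_sum_gt0 DJ.
- by rewrite !inE eqxx orbF eq_sym.
by rewrite !inE eqxx.
Qed.

Lemma is_Meas_orient_sum X : is_Meas N X <-> plucker X I != 0 /\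
  forall i j, i \in I -> j \notin I ->
    plucker X (j |: (I :\ i)) / plucker X I = Zw (j |: (I :\ i)) / Zw I.
Proof.
split=> -[XI h]; split=> // i j iI jI.
  exact: boundary_measurement_unique (h i j iI jI) (boundary_measurement_orient_sum pN iI jI).
by rewrite h //; exact: boundary_measurement_orient_sum.
Qed.

Lemma is_Meas_exists : exists X, is_Meas N X.
Proof.
have [X [XI h]] := plucker_exists (fun i j => Zw (j |: (I :\ i)) / Zw I) hk.
by exists X; apply/is_Meas_orient_sum.
Qed.

Lemma is_Meas_unique X : is_Meas N X -> unique (is_Meas N) X.
Proof.
move=> hX; split=> // X' /is_Meas_orient_sum[XI' h']; have /is_Meas_orient_sum[XI h] := hX.
by apply: (plucker_determines hk XI XI') => i j iI jI; rewrite h ?h'.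
Qed.

Lemma is_Meas_realizes X J C : is_Meas N X -> C \in reorient N J -> realizes_near X J.
Proof.
move=> /is_Meas_orient_sum[XI h] CJ; apply: realizes_near_reorient CJ => // i j iI jI.
have ZI0 : Zw I != 0 by rewrite gt_eqF // orient_sum_sources_gt0.
by have /eqP := h i j iI jI; rewrite eqr_div // => /eqP.
Qed.

End SameNetwork.

(** * Orientations of the two networks correspond *)

Section Transport.
Variables (R : realFieldType) (n : nat) (N N' : network R n) (phi : dart N -> dart N').
Hypotheses (hN : perfect N) (hN' : perfect N') (hiso : disk_map_iso phi).
Hypothesis hcolor : forall d : dart N, internal d -> degree d <> 2%N ->
  color d = color (phi d).
Implicit Types (d x : dart N) (A : {set dart N}) (J : {set 'I_n}).

Lemma iso_inj : injective phi.
Proof. by case: hiso => /bij_inj. Qed.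

Lemma internal_iso d : internal (phi d) = internal d.
Proof.
case: hiso => _ _ _ hl; apply/negb_inj; apply/internalPn/internalPn => -[i].
  by rewrite -hl => /iso_inj ->; exists i.
by move=> ->; exists i.
Qed.

Lemma vtx_iso d : vtx (phi d) = phi @: vtx d.
Proof.
case: hiso => bphi _ hu _; rewrite /vtx internal_iso; case: ifP => _; last by rewrite imset_set1.
have it k : (turn N' ^+ k)%g (phi d) = phi ((turn N ^+ k)%g d).
  elim: k => [|k IH]; first by rewrite !expg0 !perm1.
  by rewrite !expgSr !permM IH hu.
apply/setP => y; apply/porbitP/imsetP => [[k ->]|[x /porbitP[k ->] ->]].
  by exists ((turn N ^+ k)%g d); rewrite ?mem_porbit.
by exists k; rewrite it.
Qed.

Lemma card_iso (P : {set dart N'}) d :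
  #|P :&: vtx (phi d)| = #|(phi @^-1: P) :&: vtx d|.
Proof.
rewrite -(card_imset _ iso_inj); apply: eq_card => y; rewrite inE vtx_iso.
apply/andP/imsetP => [[yP /imsetP[x xv ye]]|[x]].
  by exists x; rewrite // !inE -ye yP.
by rewrite !inE => /andP[xP xv] ->; rewrite xP mem_imset //; exact: iso_inj.
Qed.

Lemma degree_split (M : network R n) (d : dart M) :
  (outdegree d + indegree d = degree d)%N.
Proof.
rewrite /degree -(cardsID [set x | out x] (vtx d)); congr addn; apply: eq_card => x.
  by rewrite !inE.
by rewrite !inE andbC.
Qed.

Lemma outdegree_iso d : internal d -> outdegree (phi d) = outdegree d.
Proof.
move=> di; have di' : internal (phi d) by rewrite internal_iso.
have dd : degree (phi d) = degree d by rewrite /degree vtx_iso card_imset //; exact: iso_inj.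
have s := degree_split d; have s' := degree_split (phi d); rewrite dd in s'.
have h := hN di; have h' := hN' di'.
(* At degree 2 perfectness forces outdegree 1 in both networks; otherwise the color decides between
   outdegree 1 and indegree 1. *)
have [d2|d2] := eqVneq (degree d) 2%N; first by lia.
have := hcolor di (elimN eqP d2); rewrite /color.
by case: eqP => e; case: eqP => e' // _; lia.
Qed.

Lemma reorient_iso J (A : {set dart N'}) :
  (A \in reorient N' J) = (phi @^-1: A \in reorient N J).
Proof.
case: (hiso) => -[psi phiK psiK] ht hu hl.
apply/reorientP/reorientP => -[h1 h2 h3]; split.
- by move=> d; rewrite !inE ht h1.
- by move=> d di; rewrite -card_iso h2 ?internal_iso // outdegree_iso.
- by move=> i; rewrite inE hl h3.
- by move=> d; have := h1 (psi d); rewrite !inE ht psiK.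
- move=> d di; rewrite -(psiK d) card_iso h2 ?outdegree_iso //.
    by rewrite -internal_iso psiK.
  by rewrite -internal_iso psiK.
by move=> i; have := h3 i; rewrite inE hl.
Qed.

Lemma orient_sum_iso (y : dart N' -> R) J : orient_sum y J = orient_sum (fun d => y (phi d)) J.
Proof.
case: (hiso) => -[psi phiK psiK] _ _ _.
rewrite /orient_sum (reindex (fun A : {set dart N} => psi @^-1: A)) /=; last first.
  exists (fun A : {set dart N'} => phi @^-1: A) => A _; apply/setP => x; rewrite !inE ?phiK ?psiK //.
have pp (A : {set dart N}) : phi @^-1: (psi @^-1: A) = A.
  by apply/setP => x; rewrite !inE phiK.
apply: eq_big => [A|A _]; first by rewrite reorient_iso pp.
rewrite /orient_weight (reindex phi) /=; last by exists psi => x _; rewrite ?phiK ?psiK.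
by apply: eq_bigl => d; rewrite !inE phiK.
Qed.

End Transport.

(** Any two orientations contain one dart of each edge: the darts where they differ are exchanged by
    [twin], under which [ka] is invariant. *)
Lemma orient_sum_scale (R : realFieldType) (n : nat) (N : network R n) (y ka : dart N -> R)
    (J0 : {set 'I_n}) O0 : O0 \in reorient N J0 ->
  (forall d, ka (twin N d) = ka d) ->
  forall J, orient_sum (fun d => ka d * y d) J = orient_weight ka O0 * orient_sum y J.
Proof.
move=> /reorientP[t0 _ _] kt J; rewrite /orient_sum mulr_sumr; apply: eq_bigr => O /reorientP[tO _ _].
rewrite /orient_weight big_split /=; congr (_ * _).
rewrite (bigID (mem O0)) [RHS](bigID (mem O)) /=; congr (_ * _).
  by apply: eq_bigl => d; rewrite andbC.
rewrite (reindex_inj (@perm_inj _ (twin N))) /=; apply: eq_big => [d|d _]; last exact: kt.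
by rewrite tO t0 negbK andbC.
Qed.

Theorem theorem10p1 (R : realFieldType) (k n : nat) (N N' : network R n)
    (phi : dart N -> dart N')
    (hN : perfect N) (hN' : perfect N')
    (hk : #|sources N| = k) (hk' : #|sources N'| = k)
    (hiso : disk_map_iso phi)
    (hcolor : forall d : dart N, internal d -> degree d <> 2%N ->
       color d = color (phi d))
    (hsame : forall d : dart N, out (phi d) = out d ->
       weight (phi d) = weight d)
    (hopp : forall d : dart N, out (phi d) = ~~ out d ->
       weight (phi d) = (weight d)^-1) :
  exists X : grassmannian R k n,
    unique (is_Meas N) X /\ unique (is_Meas N') X.
Proof.
have [X hX] := is_Meas_exists hN hk.
exists X; split; first exact: is_Meas_unique.
apply: is_Meas_unique => //; apply/is_Meas_orient_sum => //.
have O0 := reorient_self N.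
(* The orientation of N' is itself one of the orientations summed for N, so its source set can be
   reached from I. *)
have O1 : phi @^-1: [set d : dart N' | out d] \in reorient N (sources N').
  by rewrite -(reorient_iso hN hN' hiso hcolor) reorient_self.
(* On a reversed edge one dart has [reversal_weight] 1 in N and the inverse weight in N', the other
   has the weight in N and 1 in N'; both ratios are the inverse weight. *)
pose ka (d : dart N) : R := if out (phi d) == out d then 1 else (weight d)^-1.
have kat d : ka (twin N d) = ka d.
  case: hiso => _ ht _ _; rewrite /ka ht !out_twin weight_twin.
  by case: (out _); case: (out _).
have ka0 d : 0 < ka d.
  by rewrite /ka; case: ifP => _; rewrite ?ltr01 // invr_gt0 weight_gt0.
have ZE J : orient_sum (reversal_weight (N := N')) J = orient_weight ka [set d | out d] * orient_sum (reversal_weight (N := N)) J.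
  rewrite (orient_sum_iso hN hN' hiso hcolor) -(orient_sum_scale _ O0 kat) /orient_sum.
  apply: eq_bigr => A _; apply: eq_bigr => d _; rewrite /reversal_weight /ka.
  have w0 : weight d != 0 by rewrite gt_eqF // weight_gt0.
  have [e|ne] := eqVneq (out (phi d)) (out d).
    by rewrite e (hsame d e) mul1r.
  have e : out (phi d) = ~~ out d by move: ne; case: (out _); case: (out d).
  by rewrite e (hopp d e); case: (out d); rewrite ?mulr1 ?mulVf.
have c0 : orient_weight ka [set d | out d] != 0.
  by rewrite gt_eqF // /orient_weight; apply: prodr_gt0 => d _.
have [_ r1 near] := is_Meas_realizes hN hk hX O1.
have [XI _] := hX.
have ZI : orient_sum (reversal_weight (N := N)) (sources N) != 0 by rewrite gt_eqF // orient_sum_sources_gt0.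
have Z1 : orient_sum (reversal_weight (N := N)) (sources N') != 0 by rewrite gt_eqF // (orient_sum_gt0 O1).
have X1 : plucker X (sources N') != 0.
  apply: contraTneq (mulf_neq0 Z1 XI) => e.
  by rewrite -r1 e mul0r eqxx.
split=> // i j iI jI; have r := near i j iI jI.
rewrite !ZE -mulf_div divff // mul1r; apply/eqP; rewrite eqr_div //; apply/eqP.
apply: (mulIf ZI); rewrite mulrAC r.
by rewrite mulrAC -[RHS]mulrA r1; ring.
Qed.
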